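(* Let $\Delta>0$ and let $X$ be a Lévy process such that $X_\Delta$ admits a density $f_\Delta$ with respect to the Lebesgue measure. Let $n\ge 1$ be the number of observations. Then for any $\kappa>0$, the adaptive estimator $\tilde f_\Delta$ (built with parameter $\kappa$) satisfies $$\mathbb E\big[\|\tilde f_\Delta-f_\Delta\|^2\big]\le\inf_{m\in(0,n]}\Big\{9\|f_{\Delta,m}-f_\Delta\|^2+\frac{m}{\pi n}\Big(5+\big(1+(\kappa+2)\sqrt{\log n}\big)^2\Big)\Big\}+64\,n^{1-\frac{\kappa^2}{4}}.$$
   Context: The observations are the $n$ i.i.d. increments $X_{j\Delta}-X_{(j-1)\Delta}$, $j=1,\dots,n$, with $X_0=0$ a.s. Write $\phi_{X_\Delta}(u)=\mathbb E[e^{iuX_\Delta}]$, and $$\hat\phi_{X_\Delta}(u)=\frac1n\sum_{j=1}^ne^{iu(X_{j\Delta}-X_{(j-1)\Delta})},\quad u\in\mathbb R.$$ For $\kappa>0$ let $\kappa_n=1+\kappa\sqrt{\log n}$, and define $$\tilde\phi_{X_\Delta}(u)=\hat\phi_{X_\Delta}(u)\,\mathbf 1_{\{|\hat\phi_{X_\Delta}(u)|\ge\kappa_nn^{-1/2}\}},\qquad \tilde f_\Delta(x)=\frac1{2\pi}\int_{[-n,n]}e^{-iux}\,\tilde\phi_{X_\Delta}(u)\,du,\quad x\in\mathbb R.$$ For $m>0$, $f_{\Delta,m}$ is the function whose Fourier transform is $\phi_{X_\Delta}\mathbf 1_{[-m,m]}$, i.e. $f_{\Delta,m}(x)=\frac1{2\pi}\int_{-m}^me^{-iux}\phi_{X_\Delta}(u)\,du$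 (Fourier transform convention: $\mathcal Ff(u)=\int e^{iux}f(x)\,dx$). $\|\cdot\|$ is the $L^2(\mathbb R)$ norm, equal to $+\infty$ for functions not in $L^2(\mathbb R)$. *)

(* Defs.v *)
From HB Require Import structures.
From mathcomp Require Import all_boot all_order all_algebra.
From mathcomp Require Import all_classical all_reals all_analysis.
From mathcomp.real_closed Require Export complex.
Import Order.TTheory GRing.Theory Num.Theory.
Import numFieldNormedType.Exports.

Set Implicit Arguments.
Unset Strict Implicit.
Unset Printing Implicit Defensive.

Local Open Scope classical_set_scope.
Local Open Scope ring_scope.
Local Open Scope complex_scope.

Section levy.
Context d (Omega : measurableType d) (R : realType) (P : probability Omega R).

(* Since each B i may be the whole line, the product rule over the full family
   contains the product rule over every subfamily. *)
Definition mutually_independent (k : nat) (Y : 'I_k -> Omega -> R) : Prop :=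
  forall B : 'I_k -> set R, (forall i, measurable (B i)) ->
    P (\bigcap_(i in [set: 'I_k]) Y i @^-1` B i) =
    (\prod_(i < k) P (Y i @^-1` B i))%E.

(* Processes are indexed by all of R for convenience; only the times t >= 0 are
   ever constrained or used. *)
Definition independent_increments (X : R -> {RV P >-> R}) : Prop :=
  forall (k : nat) (t : nat -> R),
    0 <= t 0%N -> (forall i, (i < k)%N -> t i < t i.+1) ->
    mutually_independent (fun (i : 'I_k) w => X (t i.+1) w - X (t i) w).

Definition stationary_increments (X : R -> {RV P >-> R}) : Prop :=
  forall s h : R, 0 <= s -> 0 <= h ->
  forall B : set R, measurable B ->
    P ((fun w => X (s + h) w - X s w) @^-1` B) = P (X h @^-1` B).

Definition stochastically_continuous (X : R -> {RV P >-> R}) : Prop :=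
  forall s e : R, 0 <= s -> 0 < e ->
    P [set w | e < `|X t w - X s w|] @[t --> within [set t | 0 <= t] (nbhs s)]
      --> 0%E.

Definition cadlag (x : R -> R) : Prop :=
  (forall t, 0 <= t -> x u @[u --> t^'+] --> x t) /\
  (forall t, 0 < t -> cvg (x u @[u --> t^'-])).

Definition levy_process (X : R -> {RV P >-> R}) : Prop :=
  [/\ {ae P, forall w, X 0 w = 0},
      independent_increments X,
      stationary_increments X,
      stochastically_continuous X &
      {ae P, forall w, cadlag (fun t => X t w)}].

Definition has_density (Y : {RV P >-> R}) (f : R -> R) : Prop :=
  [/\ measurable_fun setT f, (forall x, 0 <= f x) &
      forall B : set R, measurable B ->
        distribution P Y B = (\int[lebesgue_measure]_(x in B) (f x)%:E)%E].

End levy.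

Definition cintegral d (T : measurableType d) (R : realType)
    (mu : {measure set T -> \bar R}) (D : set T) (g : T -> R[i]) : R[i] :=
  (\int[mu]_(x in D) complex.Re (g x)) +i* (\int[mu]_(x in D) complex.Im (g x)).

Section estimation.
Context (R : realType).

Definition cis (t : R) : R[i] := cos t +i* sin t.

Definition cabs (z : R[i]) : R := ComplexField.Normc.normc z.

(* +oo when g is measurable but not square integrable. *)
Definition L2norm (g : R -> R[i]) : \bar R :=
  ('N[lebesgue_measure]_2%:E[EFin \o cabs \o g])%E.

(* Inverse of the convention F f (u) = \int e^{iux} f(x) dx, cut off at m. *)
Definition truncated_inverse_fourier (phi : R -> R[i]) (m x : R) : R[i] :=
  ((2 * pi)^-1)%:C *
  cintegral lebesgue_measure `[- m, m] (fun u => cis (- (u * x)) * phi u).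

Definition char_fun d (Omega : measurableType d) (P : probability Omega R)
    (Y : {RV P >-> R}) (u : R) : R[i] :=
  cintegral P setT (fun w => cis (u * Y w)).

Definition increments d (Omega : measurableType d) (P : probability Omega R)
    (X : R -> {RV P >-> R}) (Delta : R) (n : nat) (w : Omega) : 'I_n -> R :=
  fun j => X (j.+1%:R * Delta) w - X (j%:R * Delta) w.

Section sample.
Context (n : nat) (z : 'I_n -> R).

Definition empirical_char_fun (u : R) : R[i] :=
  (n%:R^-1)%:C * \sum_(j < n) cis (u * z j).

Definition kappa_ (kappa : R) : R := 1 + kappa * Num.sqrt (ln n%:R).

Definition thresholded_char_fun (kappa u : R) : R[i] :=
  if kappa_ kappa / Num.sqrt n%:R <= cabs (empirical_char_fun u)
  then empirical_char_fun u else 0.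

Definition adaptive_estimator (kappa : R) : R -> R[i] :=
  truncated_inverse_fourier (thresholded_char_fun kappa) n%:R.

End sample.
End estimation.

Arguments increments {R d Omega P} X Delta n w _.

(* Main.v *)
Require Import Defs.
From HB Require Import structures.
From mathcomp Require Import all_boot all_order all_algebra.
From mathcomp Require Import all_classical all_reals all_analysis.
From mathcomp Require Import measurable_realfun ring lra.
Import Order.TTheory GRing.Theory Num.Theory.
Import numFieldNormedType.Exports.

(** Let phi be the characteristic function of X_Delta, c = 1/(2 pi), and for g
    supported in an interval let T g (x) be c times the integral of
    e^{-iux} g(u) du, so that f_m = T (phi 1_[-m,m]) and the estimator is
    T (phit 1_[-n,n]), where phit is the thresholded empirical characteristic
    function phihat. The proof has an analytic half, which turns L2 distances
    to f into integrals over frequencies, and a probabilistic half, which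
    bounds the error of phit at one frequency.

    Analytic half. T satisfies the Bessel inequality |T g|^2 <= c |g|^2, with
    equality when g is continuous inside its interval ([bessel_trig],
    [plancherel_trig]). Both come from damping |T g|^2 by e^{-e|x|}: the damped
    energy is the double integral of g(u) conj(g(v)) against the Poisson kernel
    2e/(e^2+(u-v)^2), a symmetric kernel of mass 2 pi that concentrates on the
    diagonal as e tends to 0. Fubini's theorem gives <T g, f> = c <g, phi>
    because f is integrable ([Rintegral_mul_trig]). Completing the square, for
    f square integrable,
      |T g - f|^2 <= c |g - phi|^2_{L2(-m,m)} + |f|^2 - c |phi|^2_{L2(-m,m)},
    with equality for g = phi ([error_le], [error_eq]). Hence the bias
    |f_m - f|^2 equals |f|^2 - c |phi|^2_{L2(-m,m)}. If f is not square
    integrable then every |f_m - f| is infinite ([square_integrable_density])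
    and so is the right-hand side of the theorem.

    Probabilistic half. The increments are independent with density f, so
    phihat(u) is a mean of n i.i.d. numbers of modulus 1 and
    E|phihat - phi|^2 <= 1/n. Thresholding at level kappa_n/sqrt n moves the
    estimate by at most that level, so E|phit - phi|^2 <= (1 + kappa_n)^2 / n
    at every frequency ([threshold_risk_variance]). At high frequencies a
    second bound is used, 9 |phi|^2 + 32 n^(-kappa^2/4)
    ([threshold_risk_tail]). If |phi|^2 >= 1/(8n), then
    |phit - phi|^2 <= |phihat - phi|^2 + |phi|^2 has mean at most 9 |phi|^2.
    If |phi|^2 < 1/(8n), a frequency can only survive the threshold when
    plus or minus the real or imaginary part of phihat exceeds
    kappa_n/sqrt(2n), an event of probability at most n^(-kappa^2/4) by
    Chernoff's bound ([sample_mean_tail]); there are four such events, and the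
    squared error never exceeds 8.

    Integrating the first bound over |u| < m and the second over m <= |u| < n
    (Tonelli) produces the penalty, the term 64 n^(1-kappa^2/4), and
    9 c |phi|^2 over m <= |u| < n; the latter plus |f_n - f|^2 is at most
    9 |f_m - f|^2 ([oracle_inequality]). *)

Local Open Scope classical_set_scope.
Local Open Scope ring_scope.
Local Open Scope complex_scope.

Set Implicit Arguments.
Unset Strict Implicit.
Unset Printing Implicit Defensive.

(** * Equality of laws extends from sets to functions *)

Section weighted_law.
Context (R : realType) d (S : measurableType d).
Local Open Scope ereal_scope.
Import HBNNSimple.

Let nnsfun_weighted (g : {nnsfun S >-> R}) d' (T : measurableType d')
    (mu : {measure set T -> \bar R}) (Z : T -> S) (W : T -> R) :
  measurable_fun setT Z -> measurable_fun setT W -> (forall x, (0 <= W x)%R) ->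
  \int[mu]_x (g (Z x) * W x)%:E =
  \sum_(r \in range g) r%:E * \int[mu]_x (\1_(g @^-1` [set r]) (Z x) * W x)%:E.
Proof.
move=> mZ mW W0.
have ge0 r x : (0 <= r * (\1_(g @^-1` [set r]) (Z x) * W x))%R.
  by rewrite mulrA mulr_ge0//; exact: nnfun_muleindic_ge0.
have mm r : measurable_fun setT
    (fun x => \1_(g @^-1` [set r]) (Z x) * W x)%R.
  apply: measurable_funM => //.
  exact: (measurableT_comp (measurable_indic _)).
under eq_integral => x _.
  rewrite fimfunE.
  rewrite mulr_fsuml.
  under eq_fsbigr do rewrite -mulrA.
  rewrite -fsumEFin//.
  under eq_fsbigr do rewrite EFinM.
  over.
rewrite ge0_integral_fsum//.
- apply: eq_fsbigr => r /set_mem [y _ <-].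
  rewrite ge0_integralZl//.
  + exact/measurable_EFinP.
  + by move=> x _; rewrite lee_fin mulr_ge0.
  + by rewrite lee_fin.
- by move=> r; apply: measurable_funeM; exact/measurable_EFinP.
- by move=> r x _; rewrite -EFinM lee_fin.
Qed.

(** By linearity the hypothesis on indicators extends to simple functions, and
    by monotone convergence to nonnegative functions. With W2 a density it turns
    expectations into integrals against the density; with W2 constant it is one
    step in the proof that independence passes from sets to functions. *)
Lemma eq_integral_weighted d1 d2 (T1 : measurableType d1)
    (T2 : measurableType d2) (mu1 : {measure set T1 -> \bar R})
    (mu2 : {measure set T2 -> \bar R}) (Z1 : T1 -> S) (Z2 : T2 -> S)
    (W1 : T1 -> R) (W2 : T2 -> R) (h : S -> R) :
  measurable_fun setT Z1 -> measurable_fun setT Z2 ->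
  measurable_fun setT W1 -> measurable_fun setT W2 ->
  (forall x, (0 <= W1 x)%R) -> (forall x, (0 <= W2 x)%R) ->
  (forall B, measurable B ->
     \int[mu1]_x (\1_B (Z1 x) * W1 x)%:E =
     \int[mu2]_x (\1_B (Z2 x) * W2 x)%:E) ->
  measurable_fun setT h -> (forall y, (0 <= h y)%R) ->
  \int[mu1]_x (h (Z1 x) * W1 x)%:E = \int[mu2]_x (h (Z2 x) * W2 x)%:E.
Proof.
move=> mZ1 mZ2 mW1 mW2 W10 W20 H mh h0.
have mEh : measurable_fun setT (EFin \o h) by apply/measurable_EFinP.
pose g := nnsfun_approx measurableT mEh.
have cvgg y : (EFin \o g ^~ y) @ \oo --> (h y)%:E.
  by apply: cvg_nnsfun_approx => // z _; rewrite lee_fin.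
have limE d' (T : measurableType d') (mu : {measure set T -> \bar R})
  (Z : T -> S)
      (W : T -> R) : measurable_fun setT Z -> measurable_fun setT W ->
      (forall x, 0 <= W x)%R ->
   \int[mu]_x (h (Z x) * W x)%:E =
   limn (fun n => \int[mu]_x (g n (Z x) * W x)%:E).
  move=> mZ mW W0; rewrite -monotone_convergence//.
  - apply: eq_integral => x _; apply/esym/cvg_lim => //.
    rewrite EFinM; under eq_fun do rewrite EFinM.
    by apply: cvgeZr => //; exact: cvgg.
  - move=> n; apply/measurable_EFinP; apply: measurable_funM => //.
    exact: measurableT_comp.
  - by move=> n x _; rewrite lee_fin mulr_ge0.
  - move=> x _ a b ab; rewrite lee_fin ler_wpM2r//.
    exact/lefP/nd_nnsfun_approx.
rewrite !limE//; congr (lim (_ @ \oo)); apply/funext => n.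
by rewrite !nnsfun_weighted//; apply: eq_fsbigr => r _; rewrite H.
Qed.

End weighted_law.

(** * Integration of real functions *)

Section integral_tools.
Context (R : realType).
Local Open Scope ereal_scope.
Import HBNNSimple.

(** The integral of a nonnegative function is a supremum over the simple
    functions below it, so it is monotone without further regularity. This is
    how the risk, an integral over the samples, is bounded by bounding the loss
    sample by sample. *)
Lemma le_integral_nonmeasurable d (T : measurableType d)
    (mu : {measure set T -> \bar R}) (f g : T -> \bar R) :
  (forall x, 0 <= f x) -> (forall x, f x <= g x) ->
  \int[mu]_x f x <= \int[mu]_x g x.
Proof.
move=> f0 fg; rewrite !ge0_integralTE//; last first.
  by move=> x; exact: le_trans (fg x).
apply: ge_ereal_sup => /= _ [h hf <-]; apply: ereal_sup_ubound.
by exists h => // x; exact: le_trans (fg x).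
Qed.

Lemma le_integrableR d (T : measurableType d) (mu : {measure set T -> \bar R})
    (D : set T) (f g : T -> R) : measurable D ->
  measurable_fun D f -> mu.-integrable D (EFin \o g) ->
  (forall x, D x -> (`|f x| <= g x)%R) -> mu.-integrable D (EFin \o f).
Proof.
move=> mD mf ig fg; apply: le_integrable ig => //; first exact/measurable_EFinP.
by move=> x Dx /=; rewrite lee_fin (le_trans (fg _ Dx))// ler_norm.
Qed.

Lemma EFin_Rintegral d (T : measurableType d) (mu : {measure set T -> \bar R})
    (D : set T) (f : T -> R) : measurable D -> mu.-integrable D (EFin \o f) ->
  (\int[mu]_(x in D) f x)%:E = \int[mu]_(x in D) (f x)%:E.
Proof. by move=> mD fi; rewrite fineK//; exact: integrable_fin_num. Qed.

Section real_integrable.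
Context d (T : measurableType d) (mu : {measure set T -> \bar R}).
Implicit Types f g : T -> R.

Lemma integrableDR f g : mu.-integrable setT (EFin \o f) ->
  mu.-integrable setT (EFin \o g) ->
  mu.-integrable setT (EFin \o (fun x => f x + g x)%R).
Proof. by move=> fi gi; exact: (integrableD measurableT fi gi). Qed.

Lemma integrableBR f g : mu.-integrable setT (EFin \o f) ->
  mu.-integrable setT (EFin \o g) ->
  mu.-integrable setT (EFin \o (fun x => f x - g x)%R).
Proof. by move=> fi gi; exact: (integrableB measurableT fi gi). Qed.

Lemma integrableZR k f : mu.-integrable setT (EFin \o f) ->
  mu.-integrable setT (EFin \o (fun x => k * f x)%R).
Proof. by move=> fi; exact: (integrableZl measurableT k fi). Qed.

Lemma integrableNR f : mu.-integrable setT (EFin \o f) ->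
  mu.-integrable setT (EFin \o (fun x => - f x)%R).
Proof.
move=> fi; rewrite (_ : EFin \o _ = EFin \o (fun x => (-1) * f x)%R).
  exact: integrableZR.
by apply/funext => x /=; rewrite mulN1r.
Qed.

Lemma integrable_measurableR f :
  mu.-integrable setT (EFin \o f) -> measurable_fun setT f.
Proof. by move=> /measurable_int /measurable_EFinP. Qed.

Lemma Rintegral_sum (I : Type) (s : seq I) (F : I -> T -> R) :
  (forall i, mu.-integrable setT (EFin \o F i)) ->
  mu.-integrable setT (EFin \o (fun x => \sum_(i <- s) F i x)%R) /\
  (\int[mu]_x (\sum_(i <- s) F i x) = \sum_(i <- s) \int[mu]_x F i x)%R.
Proof.
move=> iF; elim: s => [|i s [IHi IH]].
  rewrite big_nil; under eq_Rintegral do rewrite big_nil.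
  rewrite /Rintegral integral0; split=> //.
  rewrite (_ : _ \o _ = cst 0); first exact: integrable0.
  by apply/funext => x; rewrite /= big_nil.
split.
  rewrite (_ : _ \o _ = EFin \o (fun x => F i x + \sum_(j <- s) F j x)%R).
    exact: integrableDR.
  by apply/funext => x; rewrite /= big_cons.
rewrite big_cons -IH; under eq_Rintegral do rewrite big_cons.
by rewrite RintegralD.
Qed.

End real_integrable.

Section fubini_dominated.
Context d1 d2 (T1 : measurableType d1) (T2 : measurableType d2)
  (m1 : {sigma_finite_measure set T1 -> \bar R})
  (m2 : {sigma_finite_measure set T2 -> \bar R}).
Variables (F : T1 * T2 -> R) (p : T1 -> R) (q : T2 -> R).
Hypotheses (mF : measurable_fun setT F) (ip : m1.-integrable setT (EFin \o p))
  (iq : m2.-integrable setT (EFin \o q)) (p0 : forall x, (0 <= p x)%R)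
  (q0 : forall y, (0 <= q y)%R) (Fpq : forall x y,
    (`|F (x, y)| <= p x * q y)%R).

Let mp : measurable_fun setT (EFin \o p). Proof. exact: measurable_int ip. Qed.
Let mq : measurable_fun setT (EFin \o q). Proof. exact: measurable_int iq. Qed.
Let mFE : measurable_fun setT (EFin \o F). Proof. exact/measurable_EFinP. Qed.

Let sec1 x : m2.-integrable setT (fun y => (F (x, y))%:E).
Proof.
apply: (@le_integrableR _ _ _ _ (fun y => F (x, y)) (fun y => p x * q
  y)%R) => //.
- exact: measurableT_comp mF (measurable_pair1 _).
- exact: (@integrableZl _ _ _ m2 setT measurableT (p x) (EFin \o q)).
Qed.

Let sec2 y : m1.-integrable setT (fun x => (F (x, y))%:E).
Proof.
apply: (@le_integrableR _ _ _ _ (fun x => F (x, y)) (fun x => p x * q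
  y)%R) => //.
- exact: measurableT_comp mF (measurable_pair2 _).
- exact: (@integrableZr _ _ _ m1 setT measurableT (q y) (EFin \o p)).
Qed.

Let iF : (m1 \x m2).-integrable setT (EFin \o F).
Proof.
apply/integrable12ltyP => //.
apply: (@le_lt_trans _ _ (\int[m1]_x ((p x)%:E * \int[m2]_y (q y)%:E))).
  apply: ge0_le_integral => //.
  - by move=> x _; exact: integral_ge0.
  - apply: (measurable_fun_fubini_tonelli_F (abse \o (EFin \o F))) => //=.
    exact: measurableT_comp.
  - apply: emeasurable_funM => //.
  - move=> x _; rewrite -ge0_integralZl//; last 2 first.
    + by move=> y _; rewrite lee_fin.
    + by rewrite lee_fin.
    apply: ge0_le_integral => //.
    + by apply: measurableT_comp => //; exact: measurable_int (sec1 x).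
    + exact: measurable_funeM.
    + by move=> y _; rewrite -EFinM /= lee_fin.
rewrite ge0_integralZr//; last 2 first.
- by move=> x _; rewrite lee_fin.
- by apply: integral_ge0 => y _; rewrite lee_fin.
rewrite lte_mul_pinfty//.
- by apply: integral_ge0 => y _; rewrite lee_fin.
- exact: integrable_fin_num.
- exact: integrable_lty.
Qed.

Lemma integrable_Rintegral1 :
  m1.-integrable setT (fun x => (\int[m2]_y F (x, y))%R%:E).
Proof.
apply: eq_integrable (integrable_fubini_F iF) => // x _.
by rewrite EFin_Rintegral//; exact: sec1.
Qed.

(** The product bound makes every section integrable, so that the inner
    integrals are real numbers and Fubini's theorem can be read between real
    integrals. *)
Lemma Rintegral_exchange :
  (\int[m1]_x (\int[m2]_y F (x, y)) = \int[m2]_y (\int[m1]_x F (x, y)))%R.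
Proof.
rewrite [LHS]/Rintegral [RHS]/Rintegral; congr fine.
under eq_integral => x _ do rewrite (EFin_Rintegral _ (sec1 x))//.
under [RHS]eq_integral => y _ do rewrite (EFin_Rintegral _ (sec2 y))//.
exact: (Fubini iF).
Qed.

End fubini_dominated.

Lemma integrable_Rintegral2 d1 d2 (T1 : measurableType d1)
    (T2 : measurableType d2) (m1 : {sigma_finite_measure set T1 -> \bar R})
    (m2 : {sigma_finite_measure set T2 -> \bar R}) (F : T1 * T2 -> R)
    (p : T1 -> R) (q : T2 -> R) : measurable_fun setT F ->
  m1.-integrable setT (EFin \o p) -> m2.-integrable setT (EFin \o q) ->
  (forall x, (0 <= p x)%R) -> (forall y, (0 <= q y)%R) ->
  (forall x y, (`|F (x, y)| <= p x * q y)%R) ->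
  m2.-integrable setT (fun y => (\int[m1]_x F (x, y))%R%:E).
Proof.
move=> mF ip iq p0 q0 Fpq.
apply: (@integrable_Rintegral1 _ _ _ _ m2 m1 (fun z => F (z.2, z.1)) q p) => //.
- apply: (measurableT_comp mF); exact: (@measurable_swap _ _ T2 T1).
- by move=> y x; rewrite mulrC.
Qed.

End integral_tools.

(** * The Fourier transform of a two-sided exponential *)

Section laplace_kernel.
Context (R : realType).
Notation mu := (@lebesgue_measure R).

Lemma norm_cos_le1 (x : R) : `|cos x| <= 1.
Proof. by rewrite ler_norml cos_geN1 cos_le1. Qed.

Lemma norm_sin_le1 (x : R) : `|sin x| <= 1.
Proof. by rewrite ler_norml sin_geN1 sin_le1. Qed.

(** The weight used to regularize integrals over the line; its Fourier transform
    is the Poisson kernel. *)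
Definition laplace (e x : R) : R := expR (- (e * `|x|)).

Lemma continuous_laplace e : continuous (laplace e).
Proof.
move=> x; apply: continuous_comp; last exact: continuous_expR.
apply: continuousN; apply: continuousM; first exact: cst_continuous.
exact: norm_continuous.
Qed.

Lemma measurable_laplace e : measurable_fun setT (laplace e).
Proof. by apply: continuous_measurable_fun; exact: continuous_laplace. Qed.

Lemma laplace_ge0 e x : 0 <= laplace e x. Proof. exact: expR_ge0. Qed.

(** A primitive of (1 + cos (t x)) e^{-ex}, vanishing at infinity. *)
Let primitive (e t x : R) : R :=
  expR (- (e * x)) * ((t * sin (t * x) - e * cos (t * x)) / (e ^+ 2 + t ^+ 2)
    - e^-1).

Let is_derive_scale (f : R -> R) (k x df : R) : is_derive (k * x) 1 f df ->
  is_derive x 1 (fun y => f (k * y)) (k * df).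
Proof.
move=> fd.
have kd : is_derive x 1 ( *%R k) k.
  have := @is_deriveZ _ _ _ (id : R -> R) k x 1 1 (is_derive_id _ _).
  by rewrite /GRing.scale /= mulr1.
have h : is_derive x 1 (f \o ( *%R k)) (df * k) := is_derive1_comp fd kd.
by rewrite mulrC; exact: h.
Qed.

Let is_derive_primitive (e t x : R) : 0 < e ->
  is_derive x 1 (primitive e t) ((1 + cos (t * x)) * expR (- (e * x))).
Proof.
move=> e0.
have et0 : e ^+ 2 + t ^+ 2 != 0 by rewrite gt_eqF// ltr_wpDr ?sqr_ge0//
  exprn_gt0.
have e1 : e != 0 by rewrite gt_eqF.
have dE : is_derive x 1 (fun x => expR (- (e * x))) (- e * expR (- (e * x))).
  have := is_derive_scale (is_derive_expR (- e * x)).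
  rewrite [X in expR X]mulNr.
  by rewrite (_ : (fun y => expR (- e * y)) = (fun x => expR (- (e * x))))//;
    apply/funext => y; rewrite mulNr.
have dS := is_derive_scale (is_derive_sin (t * x)).
have dC := is_derive_scale (is_derive_cos (t * x)).
have H := is_deriveM dE (is_deriveB (is_deriveZ (e ^+ 2 + t ^+ 2)^-1
  (is_deriveB (is_deriveZ t dS) (is_deriveZ e dC))) (is_derive_cst e^-1 x 1)).
have -> : primitive e t = (fun x => expR (- (e * x))) *
   ((e ^+ 2 + t ^+ 2)^-1 \*: (t \*: (fun y => sin (t * y)) -
     e \*: (fun y => cos (t * y))) - cst e^-1).
  apply/funext => y; rewrite /primitive /=.
  by rewrite !fctE /= /GRing.scale /= [_ / _]mulrC.
apply: is_derive_eq H _; rewrite /GRing.scale /=.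
rewrite !fctE /=.
rewrite /GRing.scale /=; by field; rewrite et0 e1.
Qed.

Let cvg_primitive (e t : R) : 0 < e -> primitive e t x @[x --> +oo] --> (0 : R).
Proof.
move=> e0; pose K := (`|t| + e) / (e ^+ 2 + t ^+ 2) + e^-1.
have E0 : expR (- (e * x)) * K @[x --> +oo] --> (0 : R).
  rewrite -[X in _ --> X](mul0r K); apply: cvgMl.
  apply: (cvg_comp (fun x => e * x) (fun x => expR (- x)));
    last exact: cvgr_expR.
  exact: gt0_cvgMry.
apply/norm_cvg0P; apply: squeeze_cvgr (@cvg_cst _ _ _ _ _) E0.
near=> x; rewrite normr_ge0 /= /primitive normrM ger0_norm ?expR_ge0//.
rewrite ler_wpM2l ?expR_ge0// (le_trans (ler_normB _ _))// lerD//; last first.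
  by rewrite ger0_norm// invr_ge0 ltW.
have d0 : 0 <= (e ^+ 2 + t ^+ 2)^-1 by rewrite invr_ge0 addr_ge0 ?sqr_ge0.
rewrite normrM [`|_^-1|]ger0_norm// ler_wpM2r// (le_trans (ler_normB _ _))//
  lerD//.
  by rewrite normrM ler_piMr// norm_sin_le1.
by rewrite normrM (gtr0_norm e0) ler_piMr ?norm_cos_le1 ?ltW.
Unshelve. all: by end_near. Qed.

Let laplace_half (e t : R) : 0 < e ->
  (\int[mu]_(x in `[0%R, +oo[) ((1 + cos (t * x)) * laplace e x)%:E =
   (e / (e ^+ 2 + t ^+ 2) + e^-1)%:E)%E.
Proof.
move=> e0.
transitivity (\int[mu]_(x in `[0%R, +oo[) ((1 + cos (t * x)) * expR
  (- (e * x)))%:E)%E.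
  by apply: eq_integral => x;
    rewrite inE/= in_itv/= andbT /laplace => /ger0_norm ->.
have dP x := is_derive_primitive t x e0.
rewrite (@ge0_continuous_FTC2y _ _ (primitive e t) 0 0) //.
- rewrite -EFinB /primitive !mulr0 oppr0 expR0 sin0 cos0 mulr0 mulr1 !mul1r.
  by congr (_%:E); ring.
- apply: continuous_subspaceT => x.
  apply: cvgM.
    apply: cvgD; first exact: cvg_cst.
    apply: continuous_comp; last exact: continuous_cos.
    exact: mulrl_continuous.
  apply: continuous_comp; last exact: continuous_expR.
  apply: continuousN; exact: mulrl_continuous.
- exact: cvg_primitive.
- apply: cvg_at_right_filter; apply: differentiable_continuous.
  by apply/derivable1_diffP; have [] := dP 0.
- by move=> x _; rewrite derive1E; have [_ ->] := dP x.
Qed.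

(** The fundamental theorem of calculus on a half-line needs an integrand of
    constant sign; 1 + cos has one. Taking t = 0 evaluates the constant part,
    and the transform of the cosine follows by difference. *)
Lemma integral_laplace_1cos (e t : R) : 0 < e ->
  (\int[mu]_x ((1 + cos (t * x)) * laplace e x)%:E =
   (2 * e / (e ^+ 2 + t ^+ 2) + 2 / e)%:E)%E.
Proof.
move=> e0; rewrite ge0_symfun_integralT.
- rewrite -set_itvcy laplace_half// -EFinM; congr (_%:E).
  by rewrite mulrDr mulrA.
- by move=> x; rewrite mulr_ge0 ?laplace_ge0// -lerBlDl sub0r cos_geN1.
- move=> x; apply: cvgM; last exact: continuous_laplace.
  apply: cvgD; first exact: cvg_cst.
  apply: continuous_comp; last exact: continuous_cos.
  exact: mulrl_continuous.
- by move=> x /=; rewrite mulrN cosN /laplace normrN.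
Qed.

Lemma integrable_laplace (e : R) : 0 < e ->
  mu.-integrable setT (EFin \o laplace e).
Proof.
move=> e0; apply/integrableP; split.
  by apply/measurable_EFinP; exact: measurable_laplace.
apply: (@le_lt_trans _ _ (\int[mu]_x ((1 + cos (0 * x)) * laplace e x)%:E)%E).
  apply: le_integral_nonmeasurable => // x.
  rewrite /= lee_fin ger0_norm ?laplace_ge0// mul0r cos0.
  by rewrite ler_peMl ?laplace_ge0// lerDl.
by rewrite integral_laplace_1cos// ltry.
Qed.

Lemma measurable_cosM (t : R) : measurable_fun setT (fun x : R => cos (t * x)).
Proof.
apply: continuous_measurable_fun => x.
by apply: continuous_comp; [exact: mulrl_continuous|exact: continuous_cos].
Qed.

Lemma measurable_sinM (t : R) : measurable_fun setT (fun x : R => sin (t * x)).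
Proof.
apply: continuous_measurable_fun => x.
by apply: continuous_comp; [exact: mulrl_continuous|exact: continuous_sin].
Qed.

Lemma integrable_cos_laplace (e t : R) : 0 < e ->
  mu.-integrable setT (fun x => (cos (t * x) * laplace e x)%:E).
Proof.
move=> e0; apply: le_integrableR (integrable_laplace e0) _ => //.
  by apply: measurable_funM; [exact: measurable_cosM|exact: measurable_laplace].
move=> x _; rewrite normrM (ger0_norm (laplace_ge0 _ _)).
by rewrite ler_piMl ?laplace_ge0// norm_cos_le1.
Qed.

Lemma integrable_sin_laplace (e t : R) : 0 < e ->
  mu.-integrable setT (fun x => (sin (t * x) * laplace e x)%:E).
Proof.
move=> e0; apply: le_integrableR (integrable_laplace e0) _ => //.
  by apply: measurable_funM; [exact: measurable_sinM|exact: measurable_laplace].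
move=> x _; rewrite normrM (ger0_norm (laplace_ge0 _ _)).
by rewrite ler_piMl ?laplace_ge0// norm_sin_le1.
Qed.

Lemma Rintegral_laplace (e : R) : 0 < e -> \int[mu]_x laplace e x = 2 / e.
Proof.
move=> e0; have := integral_laplace_1cos 0 e0.
under eq_integral do rewrite mul0r cos0 EFinM.
rewrite integralZl//; last exact: integrable_laplace.
rewrite -EFin_Rintegral//; last exact: integrable_laplace.
rewrite -EFinM => -[] h; apply: (@mulfI R 2); first by rewrite pnatr_eq0.
by rewrite [LHS]h; field; rewrite gt_eqF.
Qed.

Lemma Rintegral_cos_laplace (e t : R) : 0 < e ->
  \int[mu]_x (cos (t * x) * laplace e x) = 2 * e / (e ^+ 2 + t ^+ 2).
Proof.
move=> e0; have := integral_laplace_1cos t e0.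
under eq_integral do rewrite mulrDl mul1r EFinD.
rewrite integralD//; last 2 first.
- exact: integrable_laplace.
- exact: integrable_cos_laplace.
rewrite -!EFin_Rintegral//; last 2 first.
- exact: integrable_cos_laplace.
- exact: integrable_laplace.
by rewrite -EFinD => -[]; rewrite Rintegral_laplace// addrC => /addIr.
Qed.

(** The integrand is odd. *)
Lemma Rintegral_sin_laplace (e t : R) : 0 < e ->
  \int[mu]_x (sin (t * x) * laplace e x) = 0.
Proof.
move=> e0.
have E : (\int[mu]_x (sin (t * x) * laplace e x)%:E =
    \int[mu]_x (sin (t * - x) * laplace e (- x))%:E)%E.
  (* Lebesgue measure is its own image under x |-> - x. *)
  pose h (x : measurableTypeR R) := (sin (t * x) * laplace e x)%:E.
  rewrite -[RHS]/(\int[mu]_(x in (-%R : _ -> measurableTypeR R) @^-1` setT)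
     (h \o (-%R : _ -> measurableTypeR R)) x)%E.
  rewrite -integral_pushforward//=.
  - by apply: eq_measure_integral => //= A mA _; exact/esym/lebesgue_measureN.
  - exact: measurable_int (integrable_sin_laplace t e0).
  - rewrite preimage_setT.
    rewrite (_ : h \o _ = (fun x => (-1)%:E * (sin (t * x) * laplace e
      x)%:E)%E).
      by apply: integrableZl => //; exact: integrable_sin_laplace.
    apply/funext => x; rewrite /h /= -EFinM; congr EFin.
    by rewrite mulrN sinN /laplace normrN mulNr mulN1r.
have : \int[mu]_x (sin (t * x) * laplace e x) = - \int[mu]_x
  (sin (t * x) * laplace e x).
  rewrite {1}/Rintegral E -[- _]mulN1r -RintegralZl//;
    last exact: integrable_sin_laplace.
  congr fine; apply: eq_integral => x _.
  by rewrite mulrN sinN /laplace normrN mulNr mulN1r.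
lra.
Qed.

End laplace_kernel.

(** * The trigonometric transform and its adjoint *)

Section trig_transform.
Context (R : realType).
Notation mu := (@lebesgue_measure R).
(* The measurable structure on the line that carries [lebesgue_measure]. *)
Notation RR := (measurableTypeR R).
Implicit Types (a b q : R -> R) (e x u : R).

(** For g = a + ib, the functions trig a b and trig b (-a) are the real and
    imaginary parts of the integral of e^{-iux} g(u) du. *)
Definition trig a b x : R := \int[mu]_u (a u * cos (u * x) + b u * sin (u * x)).

(** This is 2 pi times the usual Poisson kernel of the half-plane at height
    e. *)
Definition poisson e t : R := 2 * e / (e ^+ 2 + t ^+ 2).

Lemma measurable_trig_integrand a b :
  measurable_fun setT a -> measurable_fun setT b ->
  measurable_fun setT
    (fun z : RR * RR => a z.2 * cos (z.2 * z.1) + b z.2 * sin (z.2 * z.1)).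
Proof.
move=> ma mb.
have m12 : measurable_fun setT (fun z : RR * RR => z.2 * z.1).
  by apply: measurable_funM; [exact: measurable_snd|exact: measurable_fst].
apply: measurable_funD; apply: measurable_funM.
- exact: measurableT_comp ma (@measurable_snd _ _ _ _).
- by apply: measurableT_comp m12; apply: continuous_measurable_fun;
  exact: continuous_cos.
- exact: measurableT_comp mb (@measurable_snd _ _ _ _).
- by apply: measurableT_comp m12; apply: continuous_measurable_fun;
  exact: continuous_sin.
Qed.

Lemma trig_integrand_le (r s t : R) :
  `|r * cos t + s * sin t| <= `|r| + `|s|.
Proof.
rewrite (le_trans (ler_normD _ _))// !normrM.
by rewrite lerD// ler_piMr// ?norm_cos_le1 ?norm_sin_le1.
Qed.

Section fixed.
Variables (a b : R -> R).
Hypotheses (ia : mu.-integrable setT (EFin \o a))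
  (ib : mu.-integrable setT (EFin \o b)).

Let ma : measurable_fun setT a. Proof. exact: integrable_measurableR ia. Qed.
Let mb : measurable_fun setT b. Proof. exact: integrable_measurableR ib. Qed.

Let iab : mu.-integrable setT (EFin \o (fun u => `|a u| + `|b u|)).
Proof.
have -> : EFin \o (fun u => `|a u| + `|b u|) =
    (fun u => (abse \o (EFin \o a)) u + (abse \o (EFin \o b)) u)%E by [].
by apply: integrableD => //; exact: integrable_abse.
Qed.

Section against.
Variable q : R -> R.
Hypothesis iq : mu.-integrable setT (EFin \o q).

Let F (z : RR * RR) := q z.1 * (a z.2 * cos (z.2 * z.1) + b z.2 * sin
  (z.2 * z.1)).

Let mF : measurable_fun setT F.
Proof.
apply: measurable_funM; last exact: measurable_trig_integrand.
exact: measurableT_comp (integrable_measurableR iq) (@measurable_fst _ _ _ _).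
Qed.

Let F_le x u : `|F (x, u)| <= `|q x| * (`|a u| + `|b u|).
Proof. by rewrite /F normrM /= ler_wpM2l// trig_integrand_le. Qed.

Let iq' : mu.-integrable setT (EFin \o (fun x => `|q x|)).
Proof. exact: integrable_norm iq. Qed.

Lemma integrable_trig_integrand x : mu.-integrable setT
  (EFin \o (fun u => a u * cos (u * x) + b u * sin (u * x))).
Proof.
apply: le_integrableR iab _ => //; last by move=> u _; exact: trig_integrand_le.
exact: measurableT_comp (measurable_trig_integrand ma mb) (measurable_pair1 _).
Qed.

Let FE x : \int[mu]_u F (x, u) = q x * trig a b x.
Proof. by rewrite /F /= RintegralZl//; exact: integrable_trig_integrand. Qed.

Lemma integrable_mul_trig :
  mu.-integrable setT (EFin \o (fun x => q x * trig a b x)).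
Proof.
have := integrable_Rintegral1 mF iq' iab (fun=> normr_ge0 _)
  (fun=> addr_ge0 (normr_ge0 _) (normr_ge0 _)) F_le.
by under eq_fun do rewrite FE.
Qed.

Let icos u : mu.-integrable setT (EFin \o (fun x => cos (u * x) * q x)).
Proof.
apply: le_integrableR iq' _ => //.
  apply: measurable_funM; first exact: measurable_cosM.
  exact: integrable_measurableR iq.
by move=> x _; rewrite normrM ler_piMl// norm_cos_le1.
Qed.

Let isin u : mu.-integrable setT (EFin \o (fun x => sin (u * x) * q x)).
Proof.
apply: le_integrableR iq' _ => //.
  apply: measurable_funM; first exact: measurable_sinM.
  exact: integrable_measurableR iq.
by move=> x _; rewrite normrM ler_piMl// norm_sin_le1.
Qed.

Let FE2 u : \int[mu]_x F (x, u) =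
  a u * \int[mu]_x (cos (u * x) * q x) + b u * \int[mu]_x (sin (u * x) * q x).
Proof.
rewrite /F /= -!RintegralZl// -RintegralD//; last 2 first.
- exact: (integrableZR (a u) (icos u)).
- exact: (integrableZR (b u) (isin u)).
by apply: eq_Rintegral => x _; ring.
Qed.

Lemma integrable_trig_adjoint : mu.-integrable setT (EFin \o (fun u =>
  a u * \int[mu]_x (cos (u * x) * q x) + b u * \int[mu]_x (sin (u * x) * q x))).
Proof.
have := integrable_Rintegral2 mF iq' iab (fun=> normr_ge0 _)
  (fun=> addr_ge0 (normr_ge0 _) (normr_ge0 _)) F_le.
by under eq_fun do rewrite FE2.
Qed.

(** The Fourier transform is its own transpose: exchange the two integrals. *)
Lemma Rintegral_mul_trig :
  \int[mu]_x (q x * trig a b x) =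
  \int[mu]_u (a u * \int[mu]_x (cos (u * x) * q x) +
              b u * \int[mu]_x (sin (u * x) * q x)).
Proof.
under eq_Rintegral do rewrite -FE.
rewrite (Rintegral_exchange mF iq' iab (fun=> normr_ge0 _)
  (fun=> addr_ge0 (normr_ge0 _) (normr_ge0 _)) F_le).
by apply: eq_Rintegral => u _; rewrite FE2.
Qed.

End against.

(** Fubini's theorem gives the measurability of q * trig a b for integrable q; a
    positive q can then be divided out. *)
Lemma measurable_trig : measurable_fun setT (trig a b).
Proof.
have h := integrable_measurableR (integrable_mul_trig (@integrable_laplace R 1
  ltr01)).
have -> : trig a b = (fun x => laplace 1 x * trig a b x) \*
  (fun x => expR `|x|).
  apply/funext => x /=; rewrite /laplace mul1r mulrAC -expRD addNr expR0.
  by rewrite mul1r.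
apply: measurable_funM => //; apply: continuous_measurable_fun => x.
by apply: continuous_comp; [exact: norm_continuous|exact: continuous_expR].
Qed.

End fixed.

(** Real part, at the frequency u, of the Fourier transform of the damped
    transform of a + ib. Transposing moves the oscillating factor at u onto the
    kernel; the addition formulas then leave the transform of [laplace] at the
    difference of the two frequencies, and its sine part is zero. *)
Lemma cos_sin_trig_laplace a b e u : 0 < e ->
  mu.-integrable setT (EFin \o a) -> mu.-integrable setT (EFin \o b) ->
  \int[mu]_x (cos (u * x) * (laplace e x * trig a b x)) -
  \int[mu]_x (sin (u * x) * (laplace e x * trig b (fun v => - a v) x)) =
  \int[mu]_v (a v * poisson e (u - v)).
Proof.
move=> e0 ia ib.
have ic := integrable_cos_laplace u e0.
have is_ := integrable_sin_laplace u e0.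
under eq_Rintegral do rewrite mulrA.
under [X in _ - X]eq_Rintegral do rewrite mulrA.
rewrite Rintegral_mul_trig// Rintegral_mul_trig//; last exact: integrableNR.
have itrig (f g : R -> R) (v : R) : measurable_fun setT f ->
  measurable_fun setT g ->
    (forall x, `|f x| <= 1) -> (forall x, `|g x| <= 1) ->
    mu.-integrable setT (EFin \o (fun x => g x * (f x * laplace e x))).
  move=> mf mg f1 g1; apply: le_integrableR (integrable_laplace e0) _ => //.
    apply: measurable_funM => //; apply: measurable_funM => //.
    exact: measurable_laplace.
  move=> x _; rewrite !normrM (ger0_norm (laplace_ge0 _ _)) mulrA.
  by rewrite ler_piMl ?laplace_ge0// mulr_ile1.
have cm t : measurable_fun setT (fun x : R => cos (t * x))
  by exact: measurable_cosM.
have sm t : measurable_fun setT (fun x : R => sin (t * x))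
  by exact: measurable_sinM.
have c1 t : forall x : R, `|cos (t * x)| <= 1 by move=> x; exact: norm_cos_le1.
have s1 t : forall x : R, `|sin (t * x)| <= 1 by move=> x; exact: norm_sin_le1.
rewrite -RintegralB//.
- apply: eq_Rintegral => v _.
  have E1 : \int[mu]_x (cos (v * x) * (cos (u * x) * laplace e x)) +
            \int[mu]_x (sin (v * x) * (sin (u * x) * laplace e x)) =
            poisson e (u - v).
    rewrite -RintegralD//; try exact: itrig.
    rewrite /poisson -Rintegral_cos_laplace//; apply: eq_Rintegral => x _.
    by rewrite mulrBl cosB; ring.
  have E2 : \int[mu]_x (sin (v * x) * (cos (u * x) * laplace e x)) -
            \int[mu]_x (cos (v * x) * (sin (u * x) * laplace e x)) = 0.
    rewrite -RintegralB//; try exact: itrig.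
    rewrite -(Rintegral_sin_laplace (v - u) e0); apply: eq_Rintegral => x _.
    by rewrite mulrBl sinB; ring.
  rewrite -E1; move/eqP : E2; rewrite subr_eq0 => /eqP ->; ring.
- exact: integrable_trig_adjoint.
- by apply: integrable_trig_adjoint => //; exact: integrableNR.
Qed.

End trig_transform.

(** * Damped energy and the Poisson kernel *)

Section damped_energy.
Context (R : realType).
Notation mu := (@lebesgue_measure R).
Notation RR := (measurableTypeR R).
Implicit Types (a b p : R -> R) (e x u : R).

Lemma trigNN a b x : mu.-integrable setT (EFin \o a) ->
  mu.-integrable setT (EFin \o b) ->
  trig (fun v => - a v) (fun v => - b v) x = - trig a b x.
Proof.
move=> ia ib; rewrite /trig -mulN1r -RintegralZl//;
  last exact: integrable_trig_integrand.
by apply: eq_Rintegral => u _; ring.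
Qed.

(** Write the squared modulus as the transform times its conjugate and transpose
    one factor: what is left is [cos_sin_trig_laplace], applied to (a, b) for
    the real part and to (b, -a) for the imaginary part. *)
Lemma energy_laplace a b e : 0 < e ->
  mu.-integrable setT (EFin \o a) -> mu.-integrable setT (EFin \o b) ->
  \int[mu]_x (laplace e x * (trig a b x ^+ 2 + trig b (fun v => - a v) x ^+ 2))
    =
  \int[mu]_u (a u * (\int[mu]_v (a v * poisson e (u - v))) +
              b u * (\int[mu]_v (b v * poisson e (u - v)))).
Proof.
move=> e0 ia ib.
have iNa := integrableNR ia; have iNb := integrableNR ib.
have il := integrable_laplace e0.
have iA := integrable_mul_trig ia ib il.
have iB := integrable_mul_trig ib iNa il.
transitivity (\int[mu]_x (laplace e x * trig a b x * trig a b x +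
   laplace e x * trig b (fun v => - a v) x * trig b (fun v => - a v) x)).
  by apply: eq_Rintegral => x _; ring.
rewrite RintegralD//; last 2 first.
- exact: integrable_mul_trig.
- exact: integrable_mul_trig.
rewrite Rintegral_mul_trig// Rintegral_mul_trig// -RintegralD//; last 2 first.
- exact: integrable_trig_adjoint.
- exact: integrable_trig_adjoint.
apply: eq_Rintegral => u _.
rewrite -(cos_sin_trig_laplace u e0 ia ib) -(cos_sin_trig_laplace u e0 ib iNa).
under [X in _ = _ + _ * (_ - X)]eq_Rintegral.
  move=> x _; rewrite trigNN// mulrN mulrN -mulN1r.
  over.
rewrite [X in _ = _ + _ * (_ - X)]RintegralZl//; first by ring.
apply: le_integrableR (integrable_norm iA) _ => //.
  apply: measurable_funM; first exact: measurable_sinM.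
  exact: integrable_measurableR iA.
by move=> x _; rewrite normrM ler_piMl// norm_sin_le1.
Qed.

Lemma poisson_ge0 e t : 0 < e -> 0 <= poisson e t.
Proof. by move=> e0; rewrite divr_ge0 ?mulr_ge0 ?addr_ge0 ?sqr_ge0// ltW. Qed.

Lemma poisson_le e t : 0 < e -> poisson e t <= 2 / e.
Proof.
move=> e0; rewrite /poisson.
rewrite ler_pdivrMr ?ltr_wpDr ?sqr_ge0 ?exprn_gt0//.
rewrite mulrDr expr2 mulrA divfK ?gt_eqF// lerDl mulr_ge0 ?sqr_ge0//.
by rewrite divr_ge0// ltW.
Qed.

Lemma poisson_le_far e t d : 0 < e -> 0 < d -> d <= `|t| ->
  poisson e t <= 2 * e / d ^+ 2.
Proof.
move=> e0 d0 dt; rewrite /poisson ler_wpM2l ?mulr_ge0 ?(ltW e0)// lef_pV2.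
- rewrite -(real_normK (num_real t)) (@le_trans _ _ (`|t| ^+ 2))//.
    by rewrite lerXn2r// nnegrE ltW.
  by rewrite lerDr sqr_ge0.
- by rewrite posrE ltr_wpDr ?sqr_ge0// exprn_gt0.
- by rewrite posrE exprn_gt0.
Qed.

Lemma poissonC e u v : poisson e (u - v) = poisson e (v - u).
Proof. by rewrite /poisson -[(v - u) ^+ 2]sqrrN opprB. Qed.

Lemma continuous_poisson e : 0 < e -> continuous (poisson e).
Proof.
move=> e0 t; apply: cvgM; first exact: cvg_cst.
apply: cvgV; first by rewrite gt_eqF// ltr_wpDr ?sqr_ge0// exprn_gt0.
apply: cvgD; first exact: cvg_cst.
exact: exprn_continuous.
Qed.

Lemma measurable_poisson e : 0 < e -> measurable_fun setT (poisson e).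
Proof. by move=> e0; apply: continuous_measurable_fun;
  exact: continuous_poisson. Qed.

Lemma measurable_poissonB e : 0 < e ->
  measurable_fun setT (fun z : RR * RR => poisson e (z.1 - z.2)).
Proof.
move=> e0; apply: (measurableT_comp (measurable_poisson e0)).
by apply: measurable_funB; [exact: measurable_fst|exact: measurable_snd].
Qed.

Lemma measurable_poissonBl e u : 0 < e ->
  measurable_fun setT (fun v : R => poisson e (u - v)).
Proof.
move=> e0; exact: (measurableT_comp (measurable_poissonB e0)
  (measurable_pair1 u)).
Qed.

Lemma Rintegral_poisson (e u M : R) : 0 < e -> 0 < M ->
  \int[mu]_(v in `[- M, M]) poisson e (u - v) =
  2 * (atan ((M - u) / e) + atan ((M + u) / e)).
Proof.
move=> e0 M0.
pose F (v : R) := 2 * atan ((v - u) / e).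
have dF (v : R) : is_derive v 1 F (poisson e (u - v)).
  have d1 : is_derive v 1 (fun v => (v - u) / e) e^-1.
    have := @is_deriveZ _ _ _ ((id : R -> R) - cst u) e^-1 v 1 1.
    rewrite (_ : e^-1 \*: _ = (fun v => (v - u) / e)).
      rewrite /GRing.scale/= mulr1; apply.
      by apply: is_derive_eq; rewrite subr0.
    by apply/funext => w; rewrite /GRing.scale /= mulrC.
  have d2 := @is_derive1_comp _ atan (fun v => (v - u) / e) _ _ _
    (is_derive1_atan ((v - u) / e)) d1.
  have d3 := @is_deriveZ _ _ _ _ 2 v 1 _ d2.
  have -> : F = 2 \*: (atan \o (fun v => (v - u) / e)) by apply/funext => w.
  apply: is_derive_eq d3 _; rewrite /GRing.scale /= /poisson.
  have h1 : e != 0 by rewrite gt_eqF.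
  have h2 s : e ^+ 2 + s ^+ 2 != 0 by rewrite gt_eqF// ltr_wpDr ?sqr_ge0//
    exprn_gt0.
  field.
  by rewrite ?h1 ?h2.
rewrite /Rintegral (@continuous_FTC2 _ _ F).
- by rewrite /F /= -mulrBr -atanN; congr (_ * (_ + atan _));
  rewrite -mulNr opprB opprK addrC.
- by rewrite gtrN.
- apply: continuous_subspaceT => v.
  have /continuous_comp : {for v, continuous (fun v => u - v)}.
    by apply: cvgB; [exact: cvg_cst|exact: cvg_id].
  by apply; exact: continuous_poisson.
- split.
  + by move=> v _; have [] := dF v.
  + apply: cvg_at_right_filter; apply: differentiable_continuous.
    by apply/derivable1_diffP; have [] := dF (- M).
  + apply: cvg_at_left_filter; apply: differentiable_continuous.
    by apply/derivable1_diffP; have [] := dF M.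
- by move=> v _; rewrite derive1E; have [_ ->] := dF v.
Qed.

End damped_energy.

(** * Schur bound for the Poisson kernel *)

Section poisson_energy.
Context (R : realType).
Notation mu := (@lebesgue_measure R).
Notation RR := (measurableTypeR R).
Implicit Types (p q : R -> R) (e x u M C : R).

Section schur.
Variables (p q : R -> R) (e : R).
Hypotheses (ip : mu.-integrable setT (EFin \o p))
  (iq : mu.-integrable setT (EFin \o q)) (e0 : 0 < e).

Let F (z : RR * RR) := p z.1 * (q z.2 * poisson e (z.1 - z.2)).

Let mF : measurable_fun setT F.
Proof.
apply: measurable_funM.
  exact: measurableT_comp (integrable_measurableR ip) (@measurable_fst _ _ _ _).
apply: measurable_funM; last exact: measurable_poissonB.
exact: measurableT_comp (integrable_measurableR iq) (@measurable_snd _ _ _ _).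
Qed.

Let ip' : mu.-integrable setT (EFin \o (fun u => 2 / e * `|p u|)).
Proof. exact: (integrableZR (2 / e) (integrable_norm ip)). Qed.

Let iq' : mu.-integrable setT (EFin \o (fun u => `|q u|)).
Proof. exact: integrable_norm iq. Qed.

Let p0 u : 0 <= 2 / e * `|p u|.
Proof. by rewrite mulr_ge0// divr_ge0// ltW. Qed.

Let F_le u v : `|F (u, v)| <= 2 / e * `|p u| * `|q v|.
Proof.
rewrite /F /= 2!normrM (ger0_norm (poisson_ge0 _ e0)).
rewrite [leLHS](_ : _ = poisson e (u - v) * (`|p u| * `|q v|)); last by ring.
by rewrite -[leRHS]mulrA ler_wpM2r ?mulr_ge0// poisson_le.
Qed.

Lemma integrable_mul_poisson u :
  mu.-integrable setT (EFin \o (fun v => q v * poisson e (u - v))).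
Proof.
have i2 : mu.-integrable setT (EFin \o (fun v => 2 / e * `|q v|)).
  exact: (integrableZR (2 / e) iq').
apply: le_integrableR i2 _ => //.
  apply: measurable_funM; first exact: integrable_measurableR iq.
  exact: measurable_poissonBl.
move=> v _; rewrite normrM (ger0_norm (poisson_ge0 _ e0)) mulrC.
by rewrite ler_wpM2r// poisson_le.
Qed.

Let FE u : \int[mu]_v F (u, v) = p u * (\int[mu]_v (q v * poisson e (u - v))).
Proof. by rewrite /F /= RintegralZl//; exact: integrable_mul_poisson. Qed.

Lemma integrable_poisson_energy : mu.-integrable setT
  (EFin \o (fun u => p u * (\int[mu]_v (q v * poisson e (u - v))))).
Proof.
have := integrable_Rintegral1 mF ip' iq' p0 (fun=> normr_ge0 _) F_le.
by under eq_fun do rewrite FE.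
Qed.

(** Exchange the integrals; the kernel is symmetric. *)
Lemma poisson_energyC :
  \int[mu]_u (p u * (\int[mu]_v (q v * poisson e (u - v)))) =
  \int[mu]_v (q v * (\int[mu]_u (p u * poisson e (v - u)))).
Proof.
transitivity (\int[mu]_u \int[mu]_v F (u, v)).
  by apply: eq_Rintegral => u _; rewrite FE.
rewrite (Rintegral_exchange mF ip' iq' p0 (fun=> normr_ge0 _) F_le).
apply: eq_Rintegral => v _; rewrite -RintegralZl//.
  by apply: eq_Rintegral => u _; rewrite /F /= poissonC; ring.
have i2 : mu.-integrable setT (EFin \o (fun u => 2 / e * `|p u|)) by [].
apply: le_integrableR i2 _ => //.
  apply: measurable_funM; first exact: integrable_measurableR ip.
  exact: measurable_poissonBl.
move=> u _; rewrite normrM (ger0_norm (poisson_ge0 _ e0)) mulrC.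
by rewrite ler_wpM2r// poisson_le.
Qed.

End schur.

Definition supported M C p :=
  measurable_fun setT p /\ forall u, `|p u| <= C * \1_(`[- M, M]%classic) u.

Lemma integrable_itv_indic M : mu.-integrable setT
  (EFin \o \1_(`[- M, M]%classic : set R)).
Proof. exact: integrable_indic_itv. Qed.

Lemma supported_integrable M C p : supported M C p ->
  mu.-integrable setT (EFin \o p).
Proof.
move=> [mp pC].
have i2 : mu.-integrable setT (EFin \o (fun u => C * \1_(`[- M, M]%classic) u)).
  exact: (integrableZR C (integrable_itv_indic M)).
by apply: le_integrableR i2 _ => // u _; exact: pC.
Qed.

Lemma supported_sqr M C p : supported M C p ->
  supported M (C ^+ 2) (fun u => p u ^+ 2).
Proof.
move=> [mp pC]; split; first exact: measurable_funX.
move=> u; rewrite normrX; have := pC u; rewrite indicE.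
case: (_ \in _); rewrite ?mulr1 ?mulr0.
  by move=> h; rewrite lerXn2r// ?nnegrE// (le_trans _ h).
by rewrite normr_le0 => /eqP ->; rewrite normr0 expr0n.
Qed.

Lemma supported0 M C p u : supported M C p -> ~ `[- M, M]%classic u -> p u = 0.
Proof.
move=> [_ /(_ u)]; rewrite indicE => + uM; rewrite memNset// mulr0.
by rewrite normr_le0 => /eqP.
Qed.

Lemma Rintegral_indic_poisson e u M : 0 < e -> 0 < M ->
  \int[mu]_v (\1_(`[- M, M]%classic) v * poisson e (u - v)) =
  2 * (atan ((M - u) / e) + atan ((M + u) / e)).
Proof.
move=> e0 M0; rewrite -Rintegral_poisson// [RHS]Rintegral_mkcond.
apply: eq_Rintegral => v _; rewrite patchE indicE.
by case: ifP; rewrite ?mul1r ?mul0r.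
Qed.

Lemma Rintegral_indic_poisson_le e u M : 0 < e -> 0 < M ->
  \int[mu]_v (\1_(`[- M, M]%classic) v * poisson e (u - v)) <= 2 * pi.
Proof.
move=> e0 M0; rewrite Rintegral_indic_poisson// ler_wpM2l//.
rewrite [leRHS](splitr pi) lerD// ltW//; exact: atan_ltpi2.
Qed.

(** Schur's test: p u * p v <= (p u ^ 2 + p v ^ 2) / 2, the two halves have the
    same integral by symmetry, and the kernel has mass at most 2 pi in each
    variable. *)
Lemma poisson_energy_le p e M C : 0 < e -> 0 < M -> supported M C p ->
  \int[mu]_u (p u * (\int[mu]_v (p v * poisson e (u - v)))) <=
  2 * pi * \int[mu]_u (p u ^+ 2).
Proof.
move=> e0 M0 sp.
have ip := supported_integrable sp; have ip2 :=
  supported_integrable (supported_sqr sp).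
have i1 := integrable_itv_indic M.
set D : set R := `[- M, M]%classic.
have E1 := integrable_poisson_energy ip2 i1 e0.
have E2 := integrable_poisson_energy i1 ip2 e0.
apply: (@le_trans _ _ (\int[mu]_u (2^-1 *
   (p u ^+ 2 * (\int[mu]_v (\1_D v * poisson e (u - v))) +
    \1_D u * (\int[mu]_v (p v ^+ 2 * poisson e (u - v))))))).
  have E12 := integrableDR E1 E2.
  apply: le_Rintegral => //.
  - exact: integrable_poisson_energy.
  - exact: (integrableZR 2^-1 E12).
  move=> u _.
  have J1 := integrable_mul_poisson i1 e0 u.
  have J2 := integrable_mul_poisson ip2 e0 u.
  have J := integrable_mul_poisson ip e0 u.
  have K1 := integrableZR (p u ^+ 2) J1.
  have K2 := integrableZR (\1_D u) J2.
  have K12 := integrableDR K1 K2.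
  rewrite -!RintegralZl// -RintegralD// -RintegralZl//.
  apply: le_Rintegral => //.
  - exact: (integrableZR (p u) J).
  - exact: (integrableZR 2^-1 K12).
  move=> v _; move: (poisson e (u - v)) (poisson_ge0 (u - v) e0) => k k0.
  rewrite mulrA [leRHS](_ : _ =
    2^-1 * (p u ^+ 2 * \1_D v + \1_D u * p v ^+ 2) * k); last by ring.
  rewrite ler_wpM2r// !indicE.
  case: (boolP (u \in D)) => [uD|/negP uD]; last first.
    by rewrite (supported0 sp) ?expr0n/= ?mul0r ?addr0 ?mulr0// => /mem_set.
  case: (boolP (v \in D)) => [vD|/negP vD]; last first.
    by rewrite (supported0 sp (u := v)) ?expr0n/= ?mul0r ?addr0
      ?mulr0// => /mem_set.
  rewrite mulr1 mul1r.
  have := sqr_ge0 (p u - p v); lra.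
rewrite RintegralZl//; last exact: (integrableDR E1 E2).
rewrite RintegralD// [X in _ + X]poisson_energyC//.
have half (x : R) : 2^-1 * (x + x) = x by field.
rewrite half -RintegralZl//.
apply: le_Rintegral => //.
  exact: (integrableZR (2 * pi) ip2).
move=> u _; rewrite mulrC ler_wpM2r ?sqr_ge0//.
exact: Rintegral_indic_poisson_le.
Qed.

End poisson_energy.

(** * The Poisson kernel as an approximate identity *)

Section poisson_limit.
Context (R : realType).
Notation mu := (@lebesgue_measure R).
Implicit Types (p : R -> R) (u M C : R).

(** The damping parameters, decreasing to 0, so that the weights increase to
    1. *)
Definition shrink (j : nat) : R := j.+1%:R^-1.

Lemma shrink_gt0 j : 0 < shrink j. Proof. by rewrite invr_gt0. Qed.

Lemma cvg_shrink : shrink @ \oo --> (0 : R).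
Proof. exact: cvg_harmonic. Qed.

Lemma Rintegral_itv_indic M : 0 < M ->
  \int[mu]_v \1_(`[- M, M]%classic : set R) v = 2 * M.
Proof.
move=> M0; rewrite /Rintegral integral_indic//.
rewrite setIT; transitivity (fine (mu `[- M, M]%classic)) => //.
rewrite lebesgue_measure_itv/= lte_fin.
by rewrite gtrN// -EFinB /= opprK mulr_natl mulr2n.
Qed.

Lemma cvg_poisson_mass u M : 0 < M -> `|u| < M ->
  (fun j => \int[mu]_v (\1_(`[- M, M]%classic) v * poisson (shrink j) (u - v)))
    @ \oo --> 2 * pi.
Proof.
move=> M0 uM.
under eq_fun do rewrite Rintegral_indic_poisson ?shrink_gt0//.
rewrite (_ : 2 * pi = 2 * (pi / 2 + pi / 2)); last by rewrite -splitr.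
have at_y y : 0 < y -> (fun j => atan (y / shrink j)) @ \oo --> pi / 2.
  move=> y0; apply: (cvg_comp (fun j => y / shrink j) (@atan R));
    last exact: cvgy_atan.
  under eq_fun do rewrite /shrink invrK.
  have h : (fun j : nat => j.+1%:R : R) @ \oo --> +oo.
    by rewrite (cvg_shiftS (fun n : nat => n%:R : R)); exact: cvgr_idn.
  apply: (cvg_comp (fun j : nat => j.+1%:R : R) (fun r => y * r) h).
  by apply: gt0_cvgMry => //; exact: cvg_id.
move: uM; rewrite ltr_norml => /andP[u1 u2].
apply: cvgM; first exact: cvg_cst.
apply: cvgD; apply: at_y; lra.
Qed.

(** Replace p v by p u under the integral. Near u the change is small by
    continuity; at distance d from u the kernel is at most 2e/d^2 and p is
    bounded, so the change is O(e). *)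
Lemma cvg_poisson_conv p u M C : 0 < M -> supported M C p -> `|u| < M ->
  {for u, continuous p} ->
  (fun j => \int[mu]_v (p v * poisson (shrink j) (u - v))) @ \oo
    --> 2 * pi * p u.
Proof.
move=> M0 sp uM cp.
have ip := supported_integrable sp; have i1 := integrable_itv_indic M.
set D : set R := `[- M, M]%classic in i1 *.
have C0 : 0 <= C.
  have := sp.2 0; rewrite indicE mem_set; last first.
    by rewrite /= in_itv /= lerNl oppr0 ltW.
  by rewrite mulr1; exact: le_trans.
have k_cvg := cvg_poisson_mass M0 uM; rewrite -/D in k_cvg.
have kp_cvg : (fun j => (\int[mu]_v (\1_D v * poisson (shrink j) (u - v))) * p
  u)
    @ \oo --> 2 * pi * p u by apply: cvgMl.
apply/cvgrPdist_le => eta eta0.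
(* The kernel has mass at most 2 pi, so this choice contributes eta / 4. *)
have eta1 : 0 < eta / (8 * pi) by rewrite divr_gt0// mulr_gt0// pi_gt0.
have /cvgrPdist_lt/(_ _ eta1) := cp.
move=> [d /= d0 dP].
(* The contribution of the points at distance at least d, divided by e. *)
pose c := 2 * C * (2 / d ^+ 2) * (2 * M).
have d20 : 0 <= 2 / d ^+ 2 by rewrite divr_ge0// sqr_ge0.
have c1 : 0 <= 2 * C by rewrite mulr_ge0.
have c2 : 0 <= 2 * C * (2 / d ^+ 2) := mulr_ge0 c1 d20.
have c0 : 0 <= c := mulr_ge0 c2 (mulr_ge0 (ler0n _ 2) (ltW M0)).
have c_cvg : (fun j => c * shrink j) @ \oo --> (0 : R).
  by rewrite -[X in _ --> X](mulr0 c); apply: cvgMr; exact: cvg_shrink.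
have eta2 : 0 < eta / 2 by rewrite divr_gt0.
have eta4 : 0 < eta / 4 by rewrite divr_gt0.
have /cvgrPdist_le/(_ _ eta2) N1 := kp_cvg.
have /cvgrPdist_le/(_ _ eta4) N2 := c_cvg.
near=> j.
rewrite (le_trans (ler_distD ((\int[mu]_v (\1_D v * poisson (shrink j) (u - v)))
  * p u) _ _))//.
rewrite (splitr eta) lerD//; first by near: j.
have e0 := shrink_gt0 j.
have J1 := integrable_mul_poisson i1 e0 u.
have J := integrable_mul_poisson ip e0 u.
have J1' := integrableZR (p u) J1.
rewrite distrC mulrC -RintegralZl// -RintegralB//.
have JB := integrableBR J J1'.
rewrite (le_trans (le_normr_Rintegral _ JB))//.
pose rhs v := eta / (8 * pi) * (\1_D v * poisson (shrink j) (u - v)) +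
  2 * C * (2 / d ^+ 2) * shrink j * \1_D v.
have I1 := integrableZR (eta / (8 * pi)) J1.
have I2 := integrableZR (2 * C * (2 / d ^+ 2) * shrink j) i1.
have I12 := integrableDR I1 I2.
apply: (@le_trans _ _ (\int[mu]_v rhs v)).
  apply: le_Rintegral => //; first exact: integrable_norm JB.
  move=> v _; rewrite /rhs.
  have [vD|vD] := pselect (D v); last first.
    rewrite (supported0 sp vD) indicE memNset//.
    by rewrite !mul0r !mulr0 subr0 normr0 addr0.
  rewrite indicE mem_set// !mul1r mulr1 -mulrBl normrM
    (ger0_norm (poisson_ge0 _ e0)).
  have pb w : `|p w| <= C.
    rewrite (le_trans (sp.2 w))// ler_piMr//.
  have [uv|uv] := ltP `|u - v| d.
    apply: (@le_trans _ _ (eta / (8 * pi) * poisson (shrink j) (u - v))).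
      by rewrite ler_wpM2r ?poisson_ge0// distrC ltW// dP.
    by rewrite lerDl (mulr_ge0 c2)// ltW.
  apply: (@le_trans _ _ (2 * C * (2 / d ^+ 2) * shrink j)); last first.
    by rewrite lerDr mulr_ge0 ?poisson_ge0// ltW.
  rewrite -[leRHS]mulrA ler_pM//.
  - exact: poisson_ge0.
  - by rewrite (le_trans (ler_normB _ _))// mulr_natl mulr2n lerD.
  - by rewrite mulrAC; exact: poisson_le_far.
rewrite /rhs RintegralD// RintegralZl// RintegralZl//.
have -> : eta / 2 = eta / (8 * pi) * (2 * pi) + eta / 4.
  have aux (r s : R) : s != 0 -> r / 2 = r / (8 * s) * (2 * s) + r / 4.
    by move=> s0; field.
  by apply: aux; rewrite gt_eqF// pi_gt0.
rewrite lerD//.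
  by rewrite ler_wpM2l ?(ltW eta1)//; exact: Rintegral_indic_poisson_le.
have -> : \int[mu]_x \1_D x = 2 * M.
  exact: Rintegral_itv_indic.
rewrite [leLHS](_ : _ = c * shrink j); last by rewrite /c; ring.
apply: (le_trans (ler_norm _)); rewrite -normrN -sub0r.
by near: j.
Unshelve. all: by end_near. Qed.

(** Dominated convergence on top of the pointwise limit. Since p vanishes at the
    two ends of the interval, where the mass tends to pi instead of 2 pi, the
    pointwise limit holds at every point. *)
Lemma cvg_poisson_energy p M C : 0 < M -> supported M C p ->
  (forall u, `|u| < M -> {for u, continuous p}) ->
  (forall u, M <= `|u| -> p u = 0) ->
  (fun j => \int[mu]_u (p u * (\int[mu]_v (p v * poisson (shrink j) (u - v)))))
    @ \oo --> 2 * pi * \int[mu]_u (p u ^+ 2).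
Proof.
move=> M0 sp cp p0.
have ip := supported_integrable sp; have ip2 :=
  supported_integrable (supported_sqr sp).
have i1 := integrable_itv_indic M.
set D : set R := `[- M, M]%classic in i1 *.
pose f_ j u := p u * (\int[mu]_v (p v * poisson (shrink j) (u - v))).
have if_ j := integrable_poisson_energy ip ip (shrink_gt0 j).
have C0 : 0 <= C.
  have := sp.2 0; rewrite indicE mem_set; last first.
    by rewrite /= in_itv /= lerNl oppr0 ltW.
  by rewrite mulr1; exact: le_trans.
have I2 := integrableZR (C * (C * (2 * pi))) i1.
have [] := @dominated_convergence _ _ _ mu setT measurableT
  (fun j => EFin \o f_ j)
  (fun u => (2 * pi * p u ^+ 2)%:E) (fun u => (C * (C * (2 * pi)) * \1_D u)%:E).
- by move=> j; exact: measurable_int (if_ j).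
- by apply/measurable_EFinP; apply: measurable_funM => //;
  exact: measurable_funX sp.1.
- apply: aeW => u _; apply/fine_cvgP; split; first exact: nearW.
  have [uM|Mu] := ltP `|u| M; last first.
    rewrite /f_ /comp /=; under eq_fun do rewrite p0// mul0r.
    by rewrite p0// expr0n/= mulr0; exact: cvg_cst.
  rewrite (_ : 2 * pi * p u ^+ 2 = p u * (2 * pi * p u)); last by ring.
  by apply: cvgMr; exact: (cvg_poisson_conv M0 sp uM (cp u uM)).
- exact: I2.
- apply: aeW => u j _; rewrite /= lee_fin /f_ normrM [leRHS]mulrAC ler_pM//.
    exact: sp.2.
  have e0 := shrink_gt0 j.
  have J := integrable_mul_poisson ip e0 u; have J1 :=
    integrable_mul_poisson i1 e0 u.
  have K1 := integrableZR C J1.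
  rewrite (le_trans (le_normr_Rintegral _ J))//.
  apply: (@le_trans _ _ (\int[mu]_v (C * (\1_D v * poisson (shrink j)
    (u - v))))).
    apply: le_Rintegral => //; first exact: integrable_norm J.
    move=> v _; rewrite normrM (ger0_norm (poisson_ge0 _ e0)) [leRHS]mulrA.
    by rewrite ler_wpM2r ?poisson_ge0// sp.2.
  by rewrite RintegralZl// ler_wpM2l//; exact: Rintegral_indic_poisson_le.
move=> i2 _; rewrite -(EFin_Rintegral _ i2)// => /fine_cvgP[_].
by rewrite -RintegralZl.
Qed.

End poisson_limit.

(** * Bessel's inequality and Plancherel's identity *)

Section plancherel.
Context (R : realType).
Notation mu := (@lebesgue_measure R).
Variables (M C : R) (a b : R -> R).
Hypotheses (M0 : 0 < M) (sa : supported M C a) (sb : supported M C b).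

Let ia := supported_integrable sa.
Let ib := supported_integrable sb.
Let iNa := integrableNR ia.

Definition trig_sqr x := trig a b x ^+ 2 + trig b (fun v => - a v) x ^+ 2.

Lemma trig_sqr_ge0 x : 0 <= trig_sqr x.
Proof. by rewrite addr_ge0 ?sqr_ge0. Qed.

Lemma measurable_trig_sqr : measurable_fun setT trig_sqr.
Proof. by apply: measurable_funD; apply: measurable_funX;
  exact: measurable_trig. Qed.

Lemma integrable_laplace_trig_sqr e : 0 < e ->
  mu.-integrable setT (EFin \o (fun x => laplace e x * trig_sqr x)).
Proof.
move=> e0; have il := integrable_laplace e0.
have iA := integrable_mul_trig ia ib il.
have iB := integrable_mul_trig ib iNa il.
have iAA := integrable_mul_trig ia ib iA.
have iBB := integrable_mul_trig ib iNa iB.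
apply: eq_integrable (integrableDR iAA iBB) => //.
by move=> x _; rewrite /= /trig_sqr mulrDr !expr2 !mulrA.
Qed.

Definition energy e : R :=
  \int[mu]_u (a u * (\int[mu]_v (a v * poisson e (u - v)))) +
  \int[mu]_u (b u * (\int[mu]_v (b v * poisson e (u - v)))).

Lemma integral_laplace_trig_sqr e : 0 < e ->
  (\int[mu]_x (laplace e x * trig_sqr x)%:E = (energy e)%:E)%E.
Proof.
move=> e0; rewrite -EFin_Rintegral//; last exact: integrable_laplace_trig_sqr.
rewrite energy_laplace// RintegralD//; exact: integrable_poisson_energy.
Qed.

(** Monotone convergence: the damping weights increase to 1. *)
Lemma cvg_energy_shrink :
  ((energy (shrink R j))%:E @[j --> \oo] --> \int[mu]_x (trig_sqr x)%:E)%E.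
Proof.
under eq_fun do rewrite -integral_laplace_trig_sqr ?shrink_gt0//.
rewrite (_ : (\int[mu]_x (trig_sqr x)%:E)%E
  = (\int[mu]_x limn (fun j => (laplace (shrink R j) x * trig_sqr x)%:E))%E).
  apply: cvg_monotone_convergence => //.
  - move=> j; apply/measurable_EFinP; apply: measurable_funM.
      exact: measurable_laplace.
    exact: measurable_trig_sqr.
  - by move=> j x _; rewrite lee_fin mulr_ge0 ?laplace_ge0 ?trig_sqr_ge0.
  - move=> x _ i j ij; rewrite lee_fin ler_wpM2r ?trig_sqr_ge0//.
    rewrite ler_expR lerN2 ler_wpM2r// lef_pV2 ?posrE//.
    by rewrite ler_nat.
apply: eq_integral => x _; apply/esym/cvg_lim => //.
apply: cvg_EFin; first exact: nearW.
rewrite -[X in _ --> X]mul1r; apply: cvgMl.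
rewrite -expR0; apply: continuous_cvg; first exact: continuous_expR.
rewrite -oppr0; apply: cvgN; rewrite -(mul0r `|x|); apply: cvgMl.
exact: cvg_shrink.
Qed.

Lemma energy_le e : 0 < e ->
  energy e <= 2 * pi * \int[mu]_u (a u ^+ 2 + b u ^+ 2).
Proof.
move=> e0; rewrite RintegralD//; last 2 first.
- exact: supported_integrable (supported_sqr sa).
- exact: supported_integrable (supported_sqr sb).
by rewrite mulrDr lerD//;
  [exact: poisson_energy_le sa|exact: poisson_energy_le sb].
Qed.

(** Schur's bound is uniform in the damping, so it passes to the limit. *)
Lemma bessel_trig :
  (\int[mu]_x (trig_sqr x)%:E <= (2 * pi * \int[mu]_u (a u ^+ 2
    + b u ^+ 2))%:E)%E.
Proof.
rewrite -(cvg_lim _ cvg_energy_shrink)//; apply: lime_le.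
  by apply/cvg_ex; eexists; exact: cvg_energy_shrink.
by apply: nearW => j; rewrite lee_fin energy_le// shrink_gt0.
Qed.

(** Continuity makes the damped energies converge to the squared norm, by
    [cvg_poisson_energy]. *)
Lemma plancherel_trig :
  (forall u, `|u| < M -> {for u, continuous a}) ->
  (forall u, `|u| < M -> {for u, continuous b}) ->
  (forall u, M <= `|u| -> a u = 0) -> (forall u, M <= `|u| -> b u = 0) ->
  (\int[mu]_x (trig_sqr x)%:E = (2 * pi * \int[mu]_u (a u ^+ 2
    + b u ^+ 2))%:E)%E.
Proof.
move=> ca cb a0 b0; rewrite -(cvg_lim _ cvg_energy_shrink)//.
apply/cvg_lim => //; apply: cvg_EFin; first exact: nearW.
rewrite RintegralD//; last 2 first.
- exact: supported_integrable (supported_sqr sa).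
- exact: supported_integrable (supported_sqr sb).
by rewrite mulrDr; apply: cvgD; [exact: cvg_poisson_energy sa _ _|
  exact: cvg_poisson_energy sb _ _].
Qed.

End plancherel.

(** * Band-limited functions and the L2 norm *)

Section L2_error.
Context (R : realType).
Notation mu := (@lebesgue_measure R).
Local Open Scope complex_scope.

Lemma L2norm_sqr (g : R -> R[i]) :
  (L2norm g ^+ 2 =
   \int[mu]_x (complex.Re (g x) ^+ 2 + complex.Im (g x) ^+ 2)%:E)%E.
Proof.
(* The norm is defined with a real exponent, its square with an integer one. *)
have sqr (x : \bar R) : (0 <= x -> x ^+ 2 = x `^ 2)%E.
  case: x => [r| |]//; first by rewrite lee_fin poweR_EFin => r0;
    rewrite powR_mulrn.
  by rewrite poweRyr.
rewrite sqr ?Lnorm_ge0// poweR_Lnorm//.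
apply: eq_integral => x _ /=; rewrite powR_mulrn ?normr_ge0//.
congr (_%:E); rewrite real_normK ?num_real// /cabs.
by case: (g x) => u v /=; rewrite sqr_sqrtr ?addr_ge0 ?sqr_ge0.
Qed.

(** Truncation to an open interval, so that a truncated function vanishes at
    both end points. *)
Definition cut (m : R) (p : R -> R) : R -> R := p \_ `]- m, m[.

Lemma cutE (m : R) (p : R -> R) u :
  cut m p u = if u \in `]- m, m[%classic then p u else 0.
Proof. by rewrite /cut patchE. Qed.

Lemma supported_cut (m C : R) (p : R -> R) : measurable_fun setT p ->
  (forall u, `|p u| <= C) ->
  supported m C (cut m p).
Proof.
move=> mp pC; split.
  by apply/(measurable_restrictT _ _).1 => //; exact: measurable_funTS.
move=> u; rewrite cutE indicE; case: ifPn => [um|_].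
  rewrite mem_set ?mulr1//; move: um; rewrite inE/= !in_itv/=.
  by move=> /andP[? ?]; rewrite !ltW.
by rewrite normr0 mulr_ge0// (le_trans _ (pC 0)).
Qed.

Lemma cut0 (m : R) (p : R -> R) (u : R) : m <= `|u| -> cut m p u = 0.
Proof.
rewrite cutE; case: ifPn => // /set_mem /=; rewrite in_itv/= -ltr_norml.
by rewrite ltNge => /negbTE ->.
Qed.

Lemma cut_id (m : R) (p : R -> R) (u : R) : `|u| < m -> cut m p u = p u.
Proof. by move=> um; rewrite cutE mem_set//= in_itv/= -ltr_norml. Qed.

Lemma continuous_cut (m : R) (p : R -> R) (u : R) : `|u| < m ->
  {for u, continuous p} ->
  {for u, continuous (cut m p)}.
Proof.
move=> um cp; rewrite /prop_for/continuous_at cut_id//.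
apply: cvg_trans cp; apply: near_eq_cvg.
have : \forall v \near u, v \in `]- m, m[.
  by apply: near_in_itvoo; rewrite in_itv/= -ltr_norml.
by apply: filterS => v; rewrite in_itv/= -ltr_norml => /cut_id ->.
Qed.

Lemma Rintegral_cut m p : 0 < m -> mu.-integrable `[- m, m] (EFin \o p) ->
  \int[mu]_(u in `[- m, m]) p u = \int[mu]_u cut m p u.
Proof.
move=> m0 ip; rewrite -Rintegral_itv_bndo_bndc; last first.
  by apply: integrableS ip => //; apply: subset_itvl; rewrite bnd_simp.
rewrite -Rintegral_itv_obnd_cbnd; last first.
  by apply: integrableS ip => //; apply: subset_itv; rewrite bnd_simp.
by rewrite Rintegral_mkcond.
Qed.

(** The end points of the interval are negligible, and e^{-iux} (p + iq) has
    real part p cos + q sin and imaginary part q cos - p sin. *)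
Lemma truncated_inverse_fourierE (phi : R -> R[i]) (C m x : R) : 0 < m ->
  measurable_fun setT (fun u => complex.Re (phi u)) ->
  measurable_fun setT (fun u => complex.Im (phi u)) ->
  (forall u, `|complex.Re (phi u)| <= C) ->
  (forall u, `|complex.Im (phi u)| <= C) ->
  let a := cut m (fun u => complex.Re (phi u)) in
  let b := cut m (fun u => complex.Im (phi u)) in
  truncated_inverse_fourier phi m x =
  ((2 * pi)^-1 * trig a b x) +i* ((2 * pi)^-1 * trig b (fun u => - a u) x).
Proof.
move=> m0 mp mq pC qC a b.
pose p u := complex.Re (phi u); pose q u := complex.Im (phi u).
have mD : measurable (`[- m, m]%classic : set R) by [].
have i1 : mu.-integrable `[- m, m]
    (EFin \o (fun u => (C + C) * \1_(`[- m, m]%classic) u)).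
  apply: (@integrableS _ _ _ mu setT) => //.
  exact: (integrableZR (C + C) (integrable_itv_indic m)).
have aux (r s : R -> R) : measurable_fun setT r -> measurable_fun setT s ->
    (forall u, `|r u| <= C) -> (forall u, `|s u| <= C) ->
    \int[mu]_(u in `[- m, m]) (r u * cos (u * x) + s u * sin (u * x)) =
    trig (cut m r) (cut m s) x.
  move=> mr ms rC sC; rewrite Rintegral_cut//.
    apply: eq_Rintegral => u _; rewrite !cutE; case: ifP => // _.
    by rewrite !mul0r addr0.
  apply: le_integrableR i1 _ => //.
    apply: measurable_funTS; apply: measurable_funD;
      apply: measurable_funM => //.
      by under eq_fun do rewrite mulrC; exact: measurable_cosM.
    by under eq_fun do rewrite mulrC; exact: measurable_sinM.
  move=> u um; rewrite indicE mem_set// mulr1.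
  by rewrite (le_trans (trig_integrand_le _ _ _))// lerD.
rewrite /truncated_inverse_fourier /cintegral.
rewrite [X in _ * (X +i* _)](_ : _ = trig a b x); last first.
  rewrite -aux//; apply: eq_Rintegral => u _.
  rewrite /cis cosN sinN.
  by case: (phi u) => r s /=; ring.
rewrite [X in _ * (_ +i* X)](_ : _ = trig b (fun u => - a u) x); last first.
  have -> : (fun u => - a u) = cut m (fun u => - complex.Re (phi u)).
    by apply/funext => u; rewrite /a !cutE; case: ifP => // _; rewrite oppr0.
  rewrite -aux//; last 2 first.
  - exact: measurable_funN.
  - by move=> u; rewrite normrN.
  apply: eq_Rintegral => u _.
  rewrite /cis cosN sinN.
  by case: (phi u) => r s /=; ring.
by apply/eqP; rewrite eq_complex /=; apply/andP; split; apply/eqP; ring.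
Qed.

End L2_error.

(** * The L2 error of a band-limited approximation of a density *)

Section density_fourier.
Context (R : realType).
Notation mu := (@lebesgue_measure R).
Variable f : R -> R.
Hypotheses (f0 : forall x, 0 <= f x) (fi : mu.-integrable setT (EFin \o f)).

Definition fcos u := \int[mu]_x (cos (u * x) * f x).
Definition fsin u := \int[mu]_x (sin (u * x) * f x).

Let mf : measurable_fun setT f. Proof. exact: integrable_measurableR fi. Qed.

Let icos u : mu.-integrable setT (EFin \o (fun x => cos (u * x) * f x)).
Proof.
apply: le_integrableR fi _ => //.
  by apply: measurable_funM => //; exact: measurable_cosM.
by move=> x _; rewrite normrM (ger0_norm (f0 x)) ler_piMl// norm_cos_le1.
Qed.

Let isin u : mu.-integrable setT (EFin \o (fun x => sin (u * x) * f x)).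
Proof.
apply: le_integrableR fi _ => //.
  by apply: measurable_funM => //; exact: measurable_sinM.
by move=> x _; rewrite normrM (ger0_norm (f0 x)) ler_piMl// norm_sin_le1.
Qed.

Lemma norm_fcos_le u : `|fcos u| <= \int[mu]_x f x.
Proof.
rewrite (le_trans (le_normr_Rintegral _ (icos u)))//.
apply: le_Rintegral => //; first exact: integrable_norm (icos u).
by move=> x _; rewrite normrM (ger0_norm (f0 x)) ler_piMl// norm_cos_le1.
Qed.

Lemma norm_fsin_le u : `|fsin u| <= \int[mu]_x f x.
Proof.
rewrite (le_trans (le_normr_Rintegral _ (isin u)))//.
apply: le_Rintegral => //; first exact: integrable_norm (isin u).
by move=> x _; rewrite normrM (ger0_norm (f0 x)) ler_piMl// norm_sin_le1.
Qed.

Lemma continuous_fcos : continuous fcos.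
Proof.
move=> u.
have uI : u \in (`]u - 1, u + 1[%classic : set R).
  by rewrite inE/= in_itv/=; apply/andP; split; lra.
apply: (@continuity_under_integral R _ _ mu (fun l x => cos (l * x) * f x) setT
  measurableT (u - 1) (u + 1) (fun l _ => icos l) _ f fi _ u uI).
- apply: aeW => x _ l _; apply: cvgMl; apply: continuous_comp.
    exact: mulrr_continuous.
  exact: continuous_cos.
- move=> l _; apply: aeW => x _ /=.
  by rewrite normrM (ger0_norm (f0 x)) ler_piMl// norm_cos_le1.
Qed.

Lemma continuous_fsin : continuous fsin.
Proof.
move=> u.
have uI : u \in (`]u - 1, u + 1[%classic : set R).
  by rewrite inE/= in_itv/=; apply/andP; split; lra.
apply: (@continuity_under_integral R _ _ mu (fun l x => sin (l * x) * f x) setT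
  measurableT (u - 1) (u + 1) (fun l _ => isin l) _ f fi _ u uI).
- apply: aeW => x _ l _; apply: cvgMl; apply: continuous_comp.
    exact: mulrr_continuous.
  exact: continuous_sin.
- move=> l _; apply: aeW => x _ /=.
  by rewrite normrM (ger0_norm (f0 x)) ler_piMl// norm_sin_le1.
Qed.

Lemma measurable_fcos : measurable_fun setT fcos.
Proof. by apply: continuous_measurable_fun; exact: continuous_fcos. Qed.

Lemma measurable_fsin : measurable_fun setT fsin.
Proof. by apply: continuous_measurable_fun; exact: continuous_fsin. Qed.

Let c : R := (2 * pi)^-1.
Let c0 : 0 <= c. Proof. by rewrite invr_ge0 mulr_ge0// pi_ge0. Qed.

Section error.
Variables (M C : R) (a b : R -> R).
Hypotheses (M0 : 0 < M) (ma : measurable_fun setT a) (mb : measurable_fun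
  setT b)
  (aC : forall u, `|a u| <= C) (bC : forall u, `|b u| <= C).

Let sa : supported M C (cut M a). Proof. exact: supported_cut. Qed.
Let sb : supported M C (cut M b). Proof. exact: supported_cut. Qed.
Let ia := supported_integrable sa.
Let ib := supported_integrable sb.

Let A := trig (cut M a) (cut M b).
Let B := trig (cut M b) (fun u => - cut M a u).

Let mA : measurable_fun setT A. Proof. exact: measurable_trig. Qed.
Let mB : measurable_fun setT B.
Proof. by apply: measurable_trig => //; exact: integrableNR. Qed.

Let err x := (c * A x - f x) ^+ 2 + (c * B x) ^+ 2.

Let merr : measurable_fun setT err.
Proof.
apply: measurable_funD; apply: measurable_funX; last exact: measurable_funM.
by apply: measurable_funB => //; exact: measurable_funM.
Qed.

Let iAB : mu.-integrable setT (EFin \o trig_sqr (cut M a) (cut M b)).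
Proof.
have mAB := measurable_trig_sqr sa sb.
apply/integrableP; split; first exact/measurable_EFinP.
under eq_integral do rewrite /= ger0_norm ?trig_sqr_ge0//.
by rewrite (le_lt_trans (bessel_trig M0 sa sb))// ltry.
Qed.

(** By Bessel's inequality the band-limited part is square integrable; the
    density differs from it by a square integrable function. *)
Lemma square_integrable_density : (\int[mu]_x (err x)%:E < +oo)%E ->
  mu.-integrable setT (EFin \o (fun x => f x ^+ 2)).
Proof.
move=> erry.
have ierr : mu.-integrable setT (EFin \o err).
  apply/integrableP; split; first exact/measurable_EFinP.
  under eq_integral do rewrite /= ger0_norm ?addr_ge0 ?sqr_ge0//.
  exact: erry.
have I1 := integrableZR 2 ierr.
have I2 := integrableZR (2 * c ^+ 2) iAB.
have I12 := integrableDR I1 I2.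
have I : mu.-integrable setT (EFin \o
  (fun x => 2 * err x + 2 * c ^+ 2 * trig_sqr (cut M a) (cut M b) x)) := I12.
apply: le_integrableR I _ => //; first exact: measurable_funX.
move=> x _; rewrite ger0_norm ?sqr_ge0// /err /trig_sqr -/A -/B.
have := sqr_ge0 (2 * (c * A x) - f x); have := sqr_ge0 (c * B x).
nra.
Qed.

Hypothesis f2i : mu.-integrable setT (EFin \o (fun x => f x ^+ 2)).

Let fA : mu.-integrable setT (EFin \o (fun x => f x * A x)).
Proof. exact: integrable_mul_trig. Qed.

Let errE : (\int[mu]_x (err x)%:E = (c ^+ 2 * \int[mu]_x trig_sqr (cut M a)
  (cut M b) x
  - 2 * c * \int[mu]_u (cut M a u * fcos u + cut M b u * fsin u)
  + \int[mu]_x f x ^+ 2)%:E)%E.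
Proof.
rewrite -Rintegral_mul_trig// -/A.
have I1 := integrableZR (c ^+ 2) iAB.
have I2 := integrableZR (2 * c) fA.
have I12 := integrableBR I1 I2.
have I3 := integrableDR I12 f2i.
rewrite -!RintegralZl// -RintegralB// -RintegralD// EFin_Rintegral//.
apply: eq_integral => x _; congr EFin; rewrite /err /trig_sqr -/A -/B; ring.
Qed.

Let cut_supported (p q : R -> R) (K L : R) : measurable_fun setT p ->
  measurable_fun setT q ->
  (forall u, `|p u| <= K) -> (forall u, `|q u| <= L) ->
  mu.-integrable setT (EFin \o cut M (fun u => p u * q u)).
Proof.
move=> mp mq pK qL; apply: (@supported_integrable _ M (K * L)).
apply: supported_cut; first exact: measurable_funM.
by move=> u; rewrite normrM ler_pM.
Qed.

(** Completing the square. *)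
Let completion :
  \int[mu]_u (cut M a u ^+ 2 + cut M b u ^+ 2) -
  2 * \int[mu]_u (cut M a u * fcos u + cut M b u * fsin u) +
  \int[mu]_u cut M (fun u => fcos u ^+ 2 + fsin u ^+ 2) u =
  \int[mu]_u cut M (fun u => (a u - fcos u) ^+ 2 + (b u - fsin u) ^+ 2) u.
Proof.
have mc := measurable_fcos; have ms := measurable_fsin.
have I1 : mu.-integrable setT (EFin \o (fun u => cut M a u ^+ 2
  + cut M b u ^+ 2)).
  have J1 := supported_integrable (supported_sqr sa).
  have J2 := supported_integrable (supported_sqr sb).
  exact: (integrableDR J1 J2).
have I2 : mu.-integrable setT
    (EFin \o (fun u => cut M a u * fcos u + cut M b u * fsin u)).
  have J1 := cut_supported ma mc aC norm_fcos_le.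
  have J2 := cut_supported mb ms bC norm_fsin_le.
  apply: eq_integrable (integrableDR J1 J2) => //.
  by move=> u _; rewrite /= !cutE; case: ifP => // _; rewrite !mul0r.
have I3 : mu.-integrable setT (EFin \o cut M (fun u => fcos u ^+ 2
  + fsin u ^+ 2)).
  have J1 := cut_supported mc mc norm_fcos_le norm_fcos_le.
  have J2 := cut_supported ms ms norm_fsin_le norm_fsin_le.
  apply: eq_integrable (integrableDR J1 J2) => //.
  by move=> u _; rewrite /= !cutE; case: ifP => // _; rewrite addr0.
have J2 := integrableZR 2 I2.
have J12 := integrableBR I1 J2.
rewrite -RintegralZl// -RintegralB// -RintegralD//.
apply: eq_Rintegral => u _; rewrite !cutE; case: ifP => // _; ring.
Qed.

(** Expand the square. By transposition the cross term is the scalar product of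
    a + ib with the characteristic function, and the square of the band-limited
    part is bounded by Bessel's inequality. *)
Lemma error_le : (\int[mu]_x (err x)%:E <=
  (c * \int[mu]_u cut M (fun u => (a u - fcos u) ^+ 2 + (b u - fsin u) ^+ 2) u +
   (\int[mu]_x f x ^+ 2 -
    c * \int[mu]_u cut M (fun u => fcos u ^+ 2 + fsin u ^+ 2) u))%:E)%E.
Proof.
rewrite errE -completion lee_fin.
have : \int[mu]_x trig_sqr (cut M a) (cut M b) x <=
    2 * pi * \int[mu]_u (cut M a u ^+ 2 + cut M b u ^+ 2).
  by rewrite -lee_fin EFin_Rintegral//; exact: bessel_trig M0 sa sb.
move=> /(ler_wpM2l (sqr_ge0 c)).
have -> t : c ^+ 2 * (2 * pi * t) = c * t.
  by rewrite /c expr2 mulrA -[X in X * t]mulrA mulVf ?mulr1// mulf_neq0//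
    ?gt_eqF ?pi_gt0.
lra.
Qed.

(** Characteristic functions are continuous, so Bessel's inequality is an
    equality for them. *)
Lemma error_eq : (forall u, a u = fcos u) -> (forall u, b u = fsin u) ->
  (\int[mu]_x (err x)%:E = (\int[mu]_x f x ^+ 2 -
    c * \int[mu]_u cut M (fun u => fcos u ^+ 2 + fsin u ^+ 2) u)%:E)%E.
Proof.
move=> aE bE.
have E0 : \int[mu]_u cut M (fun u => (a u - fcos u) ^+ 2
  + (b u - fsin u) ^+ 2) u = 0.
  rewrite -[RHS](mul0r (fine (mu setT))) -Rintegral_cst//;
    apply: eq_Rintegral => u _.
  by rewrite cutE aE bE !subrr expr0n/= addr0; case: ifP.
have : \int[mu]_x trig_sqr (cut M a) (cut M b) x =
    2 * pi * \int[mu]_u (cut M a u ^+ 2 + cut M b u ^+ 2).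
  apply/EFin_inj; rewrite EFin_Rintegral//; apply: (plancherel_trig M0 sa sb).
  - move=> u uM; apply: continuous_cut => //.
    by rewrite (funext aE); exact: continuous_fcos.
  - move=> u uM; apply: continuous_cut => //.
    by rewrite (funext bE); exact: continuous_fsin.
  - by move=> u; exact: cut0.
  - by move=> u; exact: cut0.
rewrite errE => ->; move: E0; rewrite -completion => E0.
have -> t : c ^+ 2 * (2 * pi * t) = c * t.
  by rewrite /c expr2 mulrA -[X in X * t]mulrA mulVf ?mulr1// mulf_neq0//
    ?gt_eqF ?pi_gt0.
congr EFin.
transitivity (c * (\int[mu]_u (cut M a u ^+ 2 + cut M b u ^+ 2) -
  2 * \int[mu]_u (cut M a u * fcos u + cut M b u * fsin u) +
  \int[mu]_u cut M (fun u => fcos u ^+ 2 + fsin u ^+ 2) u)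
    + (\int[mu]_x f x ^+ 2 -
    c * \int[mu]_u cut M (fun u => fcos u ^+ 2 + fsin u ^+ 2) u));
      first by ring.
by rewrite E0 mulr0 add0r.
Qed.

End error.

End density_fourier.

(** * Independence extends from sets to functions *)

Section independence.
Context d (Omega : measurableType d) (R : realType) (P : probability Omega R).
Context (n : nat) (Z : 'I_n -> Omega -> R).
Hypotheses (mZ : forall j, measurable_fun setT (Z j))
  (indepZ : mutually_independent P Z).

Definition bounded_family (K : R) (g : 'I_n -> R -> R) :=
  forall j, measurable_fun setT (g j) /\ forall y, 0 <= g j y <= K.

Lemma bounded_prob_integrable (K : R) (X : Omega -> R) :
  measurable_fun setT X -> (forall w, `|X w| <= K) ->
  P.-integrable setT (EFin \o X).
Proof.
move=> mX XK; apply: (@le_integrableR _ _ _ P setT X (cst K)) => //.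
exact: finite_measure_integrable_cst.
Qed.

Let mgZ K g j : bounded_family K g ->
  measurable_fun setT (fun w => g j (Z j w)).
Proof. by move=> gK; exact: measurableT_comp (gK j).1 (mZ j). Qed.

Let measurable_prodZ K g (Q : pred 'I_n) : bounded_family K g ->
  measurable_fun setT (fun w => \prod_(j | Q j) g j (Z j w)).
Proof.
move=> gK; under eq_fun do rewrite big_mkcond /=.
apply: measurable_prod => j _; case: (Q j); last exact: measurable_cst.
exact: mgZ gK.
Qed.

Let prodZ_ge0 K g (Q : pred 'I_n) w : bounded_family K g ->
  0 <= \prod_(j | Q j) g j (Z j w).
Proof. by move=> gK; apply: prodr_ge0 => j _; have [_ /(_ (Z j w))/andP[]] :=
  gK j. Qed.

Let integrable_prodZ K g (Q : pred 'I_n) : bounded_family K g ->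
  P.-integrable setT (EFin \o (fun w => \prod_(j | Q j) g j (Z j w))).
Proof.
move=> gK; apply: (@bounded_prob_integrable (\prod_(j | Q j) K)).
  exact: measurable_prodZ gK.
move=> w; rewrite ger0_norm ?(prodZ_ge0 _ _ gK)//.
by apply: ler_prod => j _; exact: (gK j).2.
Qed.

(** Induction on the number k of coordinates that carry an arbitrary function,
    the others carrying indicators. Coordinate k is freed by
    [eq_integral_weighted], with the product over the other coordinates as
    weight on one side and its expectation on the other. *)
Let expectation_prod_indic K g k : bounded_family K g ->
  (forall j : 'I_n, (k <= j)%N -> exists2 B, measurable B & g j = \1_B) ->
  \int[P]_w \prod_j g j (Z j w) = \prod_j \int[P]_w g j (Z j w).
Proof.
elim: k K g => [|k IH] K g gK gB.
  have /choice[B BP] : forall j : 'I_n, exists B, measurable B /\ g j = \1_B.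
    by move=> j; have [B mB gjB] := gB j (leq0n _); exists B.
  have mB j := (BP j).1; have gE j := (BP j).2.
  have mZB j : measurable (Z j @^-1` B j) by rewrite -[X in measurable X]setTI;
    exact: mZ.
  have E1 : (\int[P]_w (\prod_j g j (Z j w))%:E = P (\bigcap_(i in [set: 'I_n])
    Z i @^-1` B i))%E.
    have mcap : measurable (\bigcap_(i in [set: 'I_n]) Z i @^-1` B i).
      by apply: fin_bigcap_measurable => //.
    transitivity (\int[P]_w (\1_(\bigcap_(i in [set: 'I_n]) Z i @^-1` B i)
      w)%:E)%E.
      2: by rewrite integral_indic// setIT.
    apply: eq_integral => w _; congr EFin.
    have [wB|wB] := pselect ((\bigcap_(i in [set: 'I_n]) Z i @^-1` B i) w).
      rewrite [RHS]indicE mem_set// big1// => j _.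
      by rewrite gE indicE mem_set//; exact: wB.
    rewrite [RHS]indicE memNset//.
    have [j wBj] : exists j, ~ B j (Z j w).
      apply: contrapT => h; apply: wB => j _ /=.
      by apply: contrapT => h'; apply: h; exists j.
    by rewrite (bigD1 j)//= gE indicE memNset// mul0r.
  rewrite /Rintegral E1 indepZ//.
  have E2 j : P (Z j @^-1` B j) = (\int[P]_w (g j (Z j w))%:E)%E.
    rewrite -[in LHS](setIT (_ @^-1` _)) -integral_indic//.
    by apply: eq_integral => w _; rewrite gE.
  have fj j : P (Z j @^-1` B j) = (fine (\int[P]_w (g j (Z j w))%:E))%:E.
    by rewrite -E2 fineK// fin_num_measure.
  rewrite (eq_bigr (fun j => (fine (\int[P]_w (g j (Z j w))%:E))%:E));
    last first.
    by move=> j _; exact: fj.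
  by rewrite prodEFin.
have [nk|kn] := leqP n k.
  by apply: (IH K) => // j; rewrite leqNgt (leq_trans (ltn_ord j) nk).
pose i := Ordinal kn.
pose W w := \prod_(j | j != i) g j (Z j w).
pose c := \prod_(j | j != i) \int[P]_w g j (Z j w).
have c0 : 0 <= c.
  by apply: prodr_ge0 => j _; apply: Rintegral_ge0 => w _; have /andP[] :=
    (gK j).2 (Z j w).
rewrite (bigD1 i)//= -/c.
under eq_Rintegral do rewrite (bigD1 i)//=.
have mW : measurable_fun setT W by exact: measurable_prodZ gK.
have W0 w : 0 <= W w by exact: prodZ_ge0 gK.
have igi : P.-integrable setT (EFin \o (fun w => g i (Z i w))).
  apply: (@bounded_prob_integrable K); first exact: mgZ gK.
  by move=> w; have /andP[? ?] := (gK i).2 (Z i w); rewrite ger0_norm.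
rewrite -RintegralZr// /Rintegral; congr fine.
apply: (@eq_integral_weighted _ _ _ _ _ _ _ P P (Z i) (Z i) W (cst c)
  (g i)) => //.
- move=> B mB.
  pose g' j := if j == i then \1_B else g j.
  have g'i : g' i = \1_B by rewrite /g' eqxx.
  have g'j j : j != i -> g' j = g j by rewrite /g' => /negbTE ->.
  (* The indicator is bounded by 1, which may exceed K. *)
  have g'K : bounded_family (Num.max 1 K) g'.
    move=> j; rewrite /g'; case: eqVneq => [_|_]; last first.
      split; first exact: (gK j).1.
      by move=> y; have /andP[-> h] := (gK j).2 y; rewrite le_max h orbT.
    split; first exact: measurable_indic.
    by move=> y; rewrite indicE; case: (_ \in _); rewrite le_max lexx ?ler01.
  have := IH _ g' g'K.
  rewrite (bigD1 i)//= g'i (eq_bigr (fun j => \int[P]_w g j (Z j w)));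
    last first.
    by move=> j /g'j ->.
  have E w : \prod_j g' j (Z j w) = \1_B (Z i w) * W w.
    rewrite (bigD1 i)//= g'i; congr (_ * _); apply: eq_bigr => j /g'j -> //.
  under eq_Rintegral do rewrite E.
  rewrite -/c => IHB.
  have iB : P.-integrable setT (EFin \o (fun w => \1_B (Z i w) : R)).
    apply: (@bounded_prob_integrable 1).
      exact: measurableT_comp (measurable_indic _) (mZ i).
    by move=> w; rewrite indicE; case: (_ \in _); rewrite ?normr1 ?normr0.
  have iBW : P.-integrable setT (EFin \o (fun w => \1_B (Z i w) * W w)).
    have := integrable_prodZ xpredT g'K.
    by under eq_fun do rewrite /= E.
  rewrite -EFin_Rintegral// IHB; last first.
    move=> j; rewrite leq_eqVlt => /predU1P[kj|kj].
      have -> : j = i by apply: val_inj.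
      by exists B.
    rewrite g'j; first exact: gB.
    by apply: contraTneq kj => ->; rewrite ltnn.
  rewrite -RintegralZr// EFin_Rintegral//.
  exact: (@integrableZr _ _ _ P setT measurableT c _ iB).
- exact: (gK i).1.
- by move=> y; have /andP[] := (gK i).2 y.
Qed.

Lemma expectation_prod K g : bounded_family K g ->
  \int[P]_w \prod_j g j (Z j w) = \prod_j \int[P]_w g j (Z j w).
Proof.
move=> gK; apply: (expectation_prod_indic (k := n) gK) => j.
by rewrite leqNgt ltn_ord.
Qed.

End independence.

(** * Exponential inequalities *)

Section exponential_bounds.
Context (R : realType).
Implicit Types (l m y : R).

Let is_derive_expRN l : is_derive l 1 (fun x => expR (- x)) (- expR (- l)).
Proof.
have := @is_derive1_comp R expR -%R l _ _ (is_derive_expR (- l))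
  (is_deriveNid _ _).
by rewrite mulrN1.
Qed.

(** Twice the hyperbolic cosine and, below, twice the hyperbolic sine. *)
Definition cosh2 l := expR l + expR (- l).
Definition sinh2 l := expR l - expR (- l).

Let is_derive_cosh2 l : is_derive l 1 cosh2 (sinh2 l).
Proof. exact: (is_deriveD (is_derive_expR l) (is_derive_expRN l)). Qed.

Let is_derive_sinh2 l : is_derive l 1 sinh2 (cosh2 l).
Proof.
have := is_deriveB (is_derive_expR l) (is_derive_expRN l).
by rewrite opprK.
Qed.

Lemma sinh2_ge0 l : 0 <= l -> 0 <= sinh2 l.
Proof. by move=> l0; rewrite subr_ge0 ler_expR; lra. Qed.

Let mvt_from0 (g dg : R -> R) l : 0 <= l ->
  (forall x : R, is_derive x 1 g (dg x)) ->
  exists2 x, 0 <= x & g l - g 0 = dg x * l.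
Proof.
move=> l0 gd; have [|x x0l gE] := @MVT_segment R g dg 0 l l0 (fun x _ => gd x).
  apply: continuous_subspaceT => x; apply: differentiable_continuous.
  by apply/derivable1_diffP; have [] := gd x.
by exists x; [move: x0l; rewrite in_itv/= => /andP[]|rewrite gE subr0].
Qed.

Lemma sinh2_le l : 0 <= l -> sinh2 l <= l * cosh2 l.
Proof.
move=> l0; pose g (x : R) := x * cosh2 x - sinh2 x.
have dg (x : R) : is_derive x 1 g (x * sinh2 x).
  have := is_deriveB (is_deriveM (is_derive_id x 1) (is_derive_cosh2 x))
    (is_derive_sinh2 x).
  by rewrite /GRing.scale /= mulr1 addrK.
have [x x0] := mvt_from0 l0 dg.
rewrite /g mul0r {2}/sinh2 oppr0 subrr subr0 subr0 => gE.
by rewrite -subr_ge0 gE !mulr_ge0// sinh2_ge0.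
Qed.

Lemma cosh2_ge0 l : 0 <= cosh2 l.
Proof. by rewrite addr_ge0 ?expR_ge0. Qed.

(** The derivative of e^{-l^2/2} cosh l has the sign of sinh l - l cosh l. *)
Lemma cosh2_le l : 0 <= l -> cosh2 l <= 2 * expR (l ^+ 2 / 2).
Proof.
move=> l0; pose g (x : R) := expR (- (x ^+ 2 / 2)) * cosh2 x.
have dsq (x : R) : is_derive x 1 (fun x => x ^+ 2 / 2) x.
  have := @is_deriveZ _ _ _ (fun y : R => y ^+ 2) 2^-1 x 1 _
    (is_deriveX 2 (is_derive_id x 1)).
  rewrite (_ : 2^-1 \*: _ = (fun x => x ^+ 2 / 2)).
    move/is_derive_eq; apply; rewrite /GRing.scale /=; lra.
  by apply/funext => y; rewrite /GRing.scale /= mulrC.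
have dg (x : R) : is_derive x 1 g (expR (- (x ^+ 2 / 2))
  * (sinh2 x - x * cosh2 x)).
  have h1 := @is_derive1_comp R (fun x => expR (- x)) (fun x => x ^+ 2
    / 2) x _ _
    (is_derive_expRN (x ^+ 2 / 2)) (dsq x).
  have := is_deriveM h1 (is_derive_cosh2 x).
  move/is_derive_eq; apply; rewrite /GRing.scale /=; ring.
have g0 : g 0 = 2.
  by rewrite /g expr0n/= mul0r oppr0 expR0 mul1r /cosh2 oppr0 expR0.
have [x x0] := mvt_from0 l0 dg; rewrite g0 => gE.
have : g l <= 2.
  rewrite -subr_le0 gE mulr_le0_ge0// mulr_ge0_le0 ?expR_ge0//.
  by rewrite subr_le0 sinh2_le.
rewrite /g => gl.
rewrite -[leLHS]mul1r -[in leLHS]expR0 -(subrr (l ^+ 2 / 2)) expRD -mulrA mulrC.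
by rewrite ler_wpM2r ?expR_ge0.
Qed.

(** The chord of the exponential between -l and l, obtained as a combination of
    the tangent inequality at l * y taken at the two ends. *)
Lemma expR_chord l y : -1 <= y <= 1 ->
  expR (l * y) <= 2^-1 * (cosh2 l + y * sinh2 l).
Proof.
move=> /andP[y1 y2]; set e := expR (l * y).
have e0 : 0 <= e by exact: expR_ge0.
have h1 : e * (1 + (l - l * y)) <= expR l.
  rewrite -[in leRHS](subrK (l * y) l) [in leRHS]addrC expRD ler_wpM2l//.
  exact: expR_ge1Dx.
have h2 : e * (1 + (- l - l * y)) <= expR (- l).
  rewrite -[in leRHS](subrK (l * y) (- l)) [in leRHS]addrC expRD ler_wpM2l//.
  exact: expR_ge1Dx.
rewrite /cosh2 /sinh2; nra.
Qed.

(** The left-hand side is the largest moment generating function of a variable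
    in [-1, 1] with mean m. Since sinh l <= l cosh l, it is at most cosh l * (1
    + l |m|). *)
Lemma cosh_sinh_le l m : 0 <= l ->
  2^-1 * (cosh2 l + m * sinh2 l) <= expR (l ^+ 2 / 2 + l * `|m|).
Proof.
move=> l0.
have h1 : m * sinh2 l <= `|m| * (l * cosh2 l).
  apply: (@le_trans _ _ (`|m| * sinh2 l)).
    by rewrite ler_wpM2r ?sinh2_ge0// ler_norm.
  by rewrite ler_wpM2l// sinh2_le.
have h2 := cosh2_le l0.
have h3 := expR_ge1Dx (l * `|m|).
have h4 : 0 <= l * `|m| by rewrite mulr_ge0.
have h5 : cosh2 l * (1 + l * `|m|) <= 2 * expR (l ^+ 2 / 2) * expR (l * `|m|).
  by rewrite ler_pM ?cosh2_ge0// addr_ge0.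
rewrite expRD; lra.
Qed.

End exponential_bounds.

(** * Means of i.i.d. bounded variables *)

Section sample_mean.
Context d (Omega : measurableType d) (R : realType) (P : probability Omega R).
Notation mu := (@lebesgue_measure R).
Context (n : nat) (Z : 'I_n -> Omega -> R) (f : R -> R).
Hypotheses (mZ : forall j, measurable_fun setT (Z j))
  (indepZ : mutually_independent P Z)
  (f0 : forall x, 0 <= f x) (fi : mu.-integrable setT (EFin \o f))
  (f1 : \int[mu]_x f x = 1)
  (lawZ : forall j B, measurable B ->
    (P (Z j @^-1` B) = \int[mu]_(x in B) (f x)%:E)%E).

Let mf : measurable_fun setT f. Proof. exact: integrable_measurableR fi. Qed.

Lemma integrable_mul_density (g : R -> R) (K : R) : measurable_fun setT g ->
  (forall y, `|g y| <= K) -> mu.-integrable setT (EFin \o (fun x => g x * f x)).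
Proof.
move=> mg gK.
have iKf := integrableZR K fi.
apply: (@le_integrableR _ _ _ mu setT _ (fun x => K * f x)) => //.
  exact: measurable_funM.
by move=> x _; rewrite normrM (ger0_norm (f0 x)) ler_wpM2r.
Qed.

Lemma Rintegral_prob_cst (r : R) : \int[P]_w r = r.
Proof.
rewrite Rintegral_cst//; have := @probability_setT _ _ _ P.
by move=> /(congr1 fine) /= h; rewrite [X in _ * X]h mulr1.
Qed.

(** Adding K makes the function nonnegative. *)
Lemma expectation_law (g : R -> R) (K : R) j : measurable_fun setT g ->
  (forall y, `|g y| <= K) -> \int[P]_w g (Z j w) = \int[mu]_x (g x * f x).
Proof.
move=> mg gK.
have K0 : 0 <= K by rewrite (le_trans _ (gK 0)).
have iP : P.-integrable setT (EFin \o (fun w => g (Z j w))).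
  by apply: (@bounded_prob_integrable _ _ _ P K) => //; exact: measurableT_comp.
have ig := integrable_mul_density mg gK.
have igf : mu.-integrable setT (EFin \o (fun x => K * f x)).
  exact: (integrableZR K fi).
have : (\int[P]_w ((g (Z j w) + K) * cst 1 w)%:E = \int[mu]_x
  ((g x + K) * f x)%:E)%E.
  apply: (@eq_integral_weighted _ _ _ _ _ _ _ P mu (Z j) id (cst 1) f
    (fun y => g y + K)) => //.
  - move=> B mB.
    under eq_integral do rewrite mulr1.
    have mZB : measurable (Z j @^-1` B) by rewrite -[X in measurable X]setTI;
      exact: mZ.
    have -> : (\int[P]_x (\1_B (Z j x))%:E = P (Z j @^-1` B))%E.
      by rewrite -[in RHS](setIT (_ @^-1` _)) -integral_indic.
    rewrite lawZ// [LHS]integral_mkcond; apply: eq_integral => x _.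
    by rewrite patchE indicE; case: ifP; rewrite ?mul1r ?mul0r.
  - by apply: measurable_funD => //; exact: measurable_cst.
  - by move=> y; have := gK y; rewrite ler_norml => /andP[]; lra.
move=> /(congr1 fine); rewrite -!/(Rintegral _ _ _).
under eq_Rintegral do rewrite mulr1.
under [RHS]eq_Rintegral do rewrite mulrDl.
rewrite RintegralD//; last exact: finite_measure_integrable_cst.
rewrite RintegralD// RintegralZl// f1 Rintegral_prob_cst mulr1.
by move=> /addIr.
Qed.

Section statistic.
Variable h : R -> R.
Hypotheses (mh : measurable_fun setT h) (h1 : forall y, `|h y| <= 1).

Let m := \int[mu]_x (h x * f x).

Definition sample_mean (w : Omega) := n%:R^-1 * \sum_(j < n) h (Z j w).

Let mhZ j : measurable_fun setT (fun w => h (Z j w)).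
Proof. exact: measurableT_comp. Qed.

Lemma measurable_sample_mean : measurable_fun setT sample_mean.
Proof.
apply: measurable_funM; first exact: measurable_cst.
exact: measurable_sum.
Qed.

Let Eh j : \int[P]_w h (Z j w) = m. Proof. exact: expectation_law. Qed.

Let ih j : P.-integrable setT (EFin \o (fun w => h (Z j w))).
Proof. exact: (@bounded_prob_integrable _ _ _ P 1). Qed.

Let ihh i j : P.-integrable setT (EFin \o (fun w => h (Z i w) * h (Z j w))).
Proof.
apply: (@bounded_prob_integrable _ _ _ P 1); first exact: measurable_funM.
by move=> w; rewrite normrM mulr_ile1.
Qed.

(** The product formula applied to the nonnegative functions 1 + h at i and j,
    and 1 elsewhere. *)
Lemma expectation_pair i j : i != j ->
  \int[P]_w (h (Z i w) * h (Z j w)) = m ^+ 2.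
Proof.
move=> ij.
pose g (k : 'I_n) : R -> R := if k == i then (fun y => 1 + h y) else
  if k == j then (fun y => 1 + h y) else cst 1.
have gi : g i = (fun y => 1 + h y) by rewrite /g eqxx.
have gj : g j = (fun y => 1 + h y) by rewrite /g eqxx eq_sym (negbTE ij).
have gk k : k != i -> k != j -> g k = cst 1.
  by rewrite /g => /negbTE -> /negbTE ->.
have h2 y : 0 <= 1 + h y <= 2.
  by have := h1 y; rewrite ler_norml => /andP[? ?]; apply/andP; split; lra.
have mg1 : measurable_fun setT (fun y => 1 + h y).
  by apply: measurable_funD => //; exact: measurable_cst.
have gK : bounded_family 2 g.
  move=> k; rewrite /g; case: ifP => _; first by split.
  case: ifP => _; first by split.
  by split => // y /=; rewrite ler01 ler1n.
have := expectation_prod mZ indepZ gK.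
have ji : j != i by rewrite eq_sym.
rewrite (bigD1 i)//= (bigD1 j)//= big1; last first.
  move=> k /andP[ki kj]; under eq_Rintegral do rewrite gk//.
  by rewrite Rintegral_prob_cst.
have E w : \prod_k g k (Z k w) = 1 + h (Z i w) + h (Z j w) + h (Z i w) * h
  (Z j w).
  rewrite (bigD1 i)//= (bigD1 j)//= big1 ?gi ?gj; first by ring.
  by move=> k /andP[ki kj]; rewrite gk.
under eq_Rintegral do rewrite E.
have i1 : P.-integrable setT (EFin \o cst (1 : R))
  by exact: finite_measure_integrable_cst.
have i2 := integrableDR i1 (ih i).
have i3 := integrableDR i2 (ih j).
rewrite RintegralD// RintegralD// RintegralD// Rintegral_prob_cst !Eh.
have E1 k : \int[P]_w (1 + h (Z k w)) = 1 + m.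
  by rewrite RintegralD// Rintegral_prob_cst Eh.
rewrite gi gj !E1 !mulr1; lra.
Qed.

(** In the double sum of covariances only the diagonal survives. *)
Lemma sample_mean_variance : (0 < n)%N ->
  \int[P]_w ((sample_mean w - m) ^+ 2) =
  n%:R^-1 * (\int[mu]_x (h x ^+ 2 * f x) - m ^+ 2).
Proof.
move=> n0.
have nn : n%:R != 0 :> R by rewrite pnatr_eq0 -lt0n.
pose T i j w := h (Z i w) * h (Z j w) - m * h (Z i w) - m * h (Z j w) + m ^+ 2.
have E w : (sample_mean w - m) ^+ 2 =
    n%:R ^- 2 * \sum_(i < n) \sum_(j < n) T i j w.
  have -> : \sum_(i < n) \sum_(j < n) T i j w
    = (\sum_(j < n) (h (Z j w) - m)) ^+ 2.
    rewrite expr2 mulr_suml; apply: eq_bigr => i _; rewrite mulr_sumr.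
    by apply: eq_bigr => j _; rewrite /T; ring.
  rewrite sumrB sumr_const card_ord -[m *+ n]mulr_natl /sample_mean; field.
  exact: nn.
have iT i j : P.-integrable setT (EFin \o T i j).
  have I1 := integrableZR m (ih i).
  have I2 := integrableZR m (ih j).
  have I3 := integrableBR (ihh i j) I1.
  have I4 := integrableBR I3 I2.
  have I5 : P.-integrable setT (EFin \o cst (m ^+ 2))
    by exact: finite_measure_integrable_cst.
  exact: (integrableDR I4 I5).
have ET i j : \int[P]_w T i j w =
    if i == j then \int[mu]_x (h x ^+ 2 * f x) - m ^+ 2 else 0.
  have I1 := integrableZR m (ih i).
  have I2 := integrableZR m (ih j).
  have I3 := integrableBR (ihh i j) I1.
  have I4 := integrableBR I3 I2.
  rewrite /T RintegralD//; last exact: finite_measure_integrable_cst.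
  rewrite RintegralB// RintegralB// Rintegral_prob_cst.
  rewrite (@RintegralZl _ _ _ P setT (fun w => h (Z i w)) m)//.
  rewrite (@RintegralZl _ _ _ P setT (fun w => h (Z j w)) m)// !Eh.
  case: eqVneq => [<-|ij]; last by rewrite expectation_pair//=; ring.
  under eq_Rintegral do rewrite -expr2.
  rewrite (@expectation_law (fun y => h y ^+ 2) 1)/=; first by ring.
    exact: measurable_funX.
  by move=> y; rewrite normrX exprn_ile1.
under eq_Rintegral do rewrite E.
have S1 i := Rintegral_sum (index_enum 'I_n) (iT i).
have [S2 E2] := Rintegral_sum (index_enum 'I_n) (fun i => (S1 i).1).
rewrite RintegralZl// E2; under eq_bigr do rewrite (S1 _).2.
under eq_bigr => i _.
  rewrite (bigD1 i)//= ET eqxx big1; last first.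
    by move=> j ji; rewrite ET eq_sym (negbTE ji).
  over.
rewrite sumr_const card_ord addr0 -mulr_natl; field.
exact: nn.
Qed.

(** A bound without centering h: when m is small compared with the level t it
    costs no more than replacing t by t - |m|, and avoids the moment bound for
    variables in a non-symmetric interval. *)
Lemma exp_moment_le l : 0 <= l ->
  \int[mu]_x (expR (l * h x) * f x) <= expR (l ^+ 2 / 2 + l * `|m|).
Proof.
move=> l0.
have h1' y : -1 <= h y <= 1 by rewrite -ler_norml.
have mel : measurable_fun setT (fun y => expR (l * h y)).
  apply: measurableT_comp; first exact: measurable_expR.
  by apply: measurable_funM => //; exact: measurable_cst.
have ie : mu.-integrable setT (EFin \o (fun x => expR (l * h x) * f x)).
  apply: (@integrable_mul_density _ (expR l)) => //.
  move=> y; rewrite ger0_norm ?expR_ge0// ler_expR ler_piMr//.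
  by have /andP[] := h1' y.
have ihf : mu.-integrable setT (EFin \o (fun x => h x * f x)).
  exact: (@integrable_mul_density _ 1).
have I1 := integrableZR (2^-1 * cosh2 l) fi.
have I2 := integrableZR (2^-1 * sinh2 l) ihf.
have I3 := integrableDR I1 I2.
apply: (@le_trans _ _ (\int[mu]_x (2^-1 * cosh2 l * f x + 2^-1 * sinh2 l
  * (h x * f x)))).
  apply: le_Rintegral => // x _.
  have := ler_wpM2r (f0 x) (expR_chord l (h1' x)); lra.
rewrite RintegralD//.
rewrite (@RintegralZl _ _ _ mu setT f)// f1.
rewrite (@RintegralZl _ _ _ mu setT (fun x => h x * f x))// -/m.
have := cosh_sinh_le m l0; lra.
Qed.

(** Chernoff's bound; the exponent - l t + l^2/2 + l |m| is smallest at l = t -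
    |m|. *)
Lemma sample_mean_tail t : (0 < n)%N -> `|m| <= t ->
  (P [set w | (t <= sample_mean w)%R]
    <= (expR (- (n%:R * (t - `|m|) ^+ 2 / 2)))%:E)%E.
Proof.
move=> n0 mt; set l := t - `|m|.
have l0 : 0 <= l by rewrite subr_ge0.
have nn : n%:R != 0 :> R by rewrite pnatr_eq0 -lt0n.
pose A := [set w | t <= sample_mean w].
have mA : measurable A.
  rewrite -[A]setTI; apply: (@measurable_fun_ler _ _ _ _ (cst t)
    sample_mean) => //.
  exact: measurable_sample_mean.
pose g (j : 'I_n) y := expR (l * h y).
have mg : measurable_fun setT (fun y => expR (l * h y)).
  apply: measurableT_comp; first exact: measurable_expR.
  by apply: measurable_funM => //; exact: measurable_cst.
have gK : bounded_family (expR l) g.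
  move=> j; split=> // y; rewrite expR_ge0 ler_expR ler_piMr//.
  by rewrite (le_trans (ler_norm _)).
have prodE w : \prod_j g j (Z j w) = expR (l * (n%:R * sample_mean w)).
  by rewrite /g -expR_sum -mulr_sumr /sample_mean mulrA mulfV// mul1r.
have iprod : P.-integrable setT (EFin \o (fun w => \prod_j g j (Z j w))).
  apply: (@bounded_prob_integrable _ _ _ P (\prod_(j < n) expR l)).
    by apply: measurable_prod => j _; exact: measurableT_comp mg (mZ j).
  move=> w; rewrite ger0_norm; last by apply: prodr_ge0 => j _; exact: expR_ge0.
  by apply: ler_prod => j _; exact: (gK j).2.
have iA : P.-integrable setT (EFin \o (\1_A : Omega -> R)).
  apply: (@bounded_prob_integrable _ _ _ P 1); first exact: measurable_indic.
  by move=> w; rewrite indicE; case: (_ \in _); rewrite ?normr1 ?normr0.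
have -> : P A = (\int[P]_w \1_A w)%:E.
  by rewrite EFin_Rintegral// integral_indic// setIT.
rewrite lee_fin.
have I1 := integrableZR (expR (- (l * (n%:R * t)))) iprod.
apply: (@le_trans _ _ (\int[P]_w (expR (- (l * (n%:R * t))) * \prod_j g j
  (Z j w)))).
  apply: le_Rintegral => // w _; rewrite prodE -expRD indicE.
  case: (boolP (w \in A)) => [/set_mem wA|_]; last exact: expR_ge0.
  rewrite -expR0 ler_expR addrC subr_ge0 ler_wpM2l// ler_wpM2l//.
rewrite RintegralZl// (expectation_prod mZ indepZ gK).
rewrite (eq_bigr (fun=> \int[mu]_x (expR (l * h x) * f x))); last first.
  move=> j _; rewrite (@expectation_law (fun y => expR (l * h y)) (expR l))//.
  by move=> y; have [_ /(_ y)/andP[? ?]] := gK j; rewrite ger0_norm.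
rewrite prodr_const card_ord.
apply: (@le_trans _ _ (expR (- (l * (n%:R * t))) * expR (l ^+ 2 / 2
  + l * `|m|) ^+ n)).
  rewrite ler_wpM2l ?expR_ge0// lerXn2r ?nnegrE ?expR_ge0//.
    by apply: Rintegral_ge0 => x _; rewrite mulr_ge0 ?expR_ge0.
  exact: exp_moment_le.
rewrite -expRM_natl -expRD ler_expR le_eqVlt; apply/orP; left; apply/eqP.
rewrite (_ : t = l + `|m|); last by rewrite /l subrK.
by field.
Qed.

End statistic.

End sample_mean.

(** * Risk of the thresholded characteristic function at one frequency *)

Section threshold_risk.
Context d (Omega : measurableType d) (R : realType) (P : probability Omega R).
Notation mu := (@lebesgue_measure R).
Context (n : nat) (Z : 'I_n -> Omega -> R) (f : R -> R).
Hypotheses (mZ : forall j, measurable_fun setT (Z j))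
  (indepZ : mutually_independent P Z)
  (f0 : forall x, 0 <= f x) (fi : mu.-integrable setT (EFin \o f))
  (f1 : \int[mu]_x f x = 1)
  (lawZ : forall j B, measurable B ->
    (P (Z j @^-1` B) = \int[mu]_(x in B) (f x)%:E)%E)
  (n0 : (0 < n)%N).
Variables (kappa : R) (kappa0 : 0 < kappa) (u : R).

Let Sc := sample_mean Z (fun x => cos (u * x)).
Let Ss := sample_mean Z (fun x => sin (u * x)).
Let alpha := fcos f u.
Let beta := fsin f u.
Let L := Num.sqrt (ln n%:R) : R.
Let kn := kappa_ n kappa.

Definition kept w : bool :=
  kappa_ n kappa / Num.sqrt n%:R <= Num.sqrt (Sc w ^+ 2 + Ss w ^+ 2).

(** Squared modulus of the error of the thresholded empirical characteristic
    function at the frequency u. *)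
Definition threshold_error w :=
  if kept w then (Sc w - alpha) ^+ 2 + (Ss w - beta) ^+ 2
  else alpha ^+ 2 + beta ^+ 2.

Let mc : measurable_fun setT (fun x : R => cos (u * x)).
Proof. exact: measurable_cosM. Qed.
Let ms : measurable_fun setT (fun x : R => sin (u * x)).
Proof. exact: measurable_sinM. Qed.
Let c1 x : `|cos (u * x) : R| <= 1. Proof. exact: norm_cos_le1. Qed.
Let s1 x : `|sin (u * x) : R| <= 1. Proof. exact: norm_sin_le1. Qed.

Let mSc : measurable_fun setT Sc. Proof. exact: measurable_sample_mean. Qed.
Let mSs : measurable_fun setT Ss. Proof. exact: measurable_sample_mean. Qed.

Let nR : 0 < n%:R :> R. Proof. by rewrite ltr0n. Qed.
Let L0 : 0 <= L. Proof. exact: sqrtr_ge0. Qed.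
Let kn1 : 1 <= kn. Proof. by rewrite lerDl mulr_ge0// ltW. Qed.

Lemma kept_sqr w : kept w = (kn ^+ 2 / n%:R <= Sc w ^+ 2 + Ss w ^+ 2).
Proof.
have kn0 : 0 <= kn by rewrite (le_trans ler01).
have -> : kn ^+ 2 / n%:R = (kn / Num.sqrt n%:R) ^+ 2.
  by rewrite exprMn exprVn sqr_sqrtr// ltW.
rewrite /kept -/kn -[X in _ = (_ <= X)]sqr_sqrtr ?addr_ge0 ?sqr_ge0//.
by rewrite ler_sqr// ?nnegrE ?sqrtr_ge0// divr_ge0// sqrtr_ge0.
Qed.

Lemma sample_mean_le1 (h : R -> R) w : (forall x, `|h x| <= 1) ->
  `|sample_mean Z h w| <= 1.
Proof.
move=> h1; rewrite /sample_mean normrM ger0_norm ?invr_ge0// mulrC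
  ler_pdivrMr// mul1r.
rewrite (le_trans (ler_norm_sum _ _ _))//.
apply: (@le_trans _ _ (\sum_(i < n) 1)); first exact: ler_sum.
by rewrite sumr_const card_ord.
Qed.

Let mkept : measurable [set w | kept w].
Proof.
under eq_set do rewrite kept_sqr.
rewrite -[X in measurable X]setTI.
apply: (@measurable_fun_ler _ _ _ _ (cst (kn ^+ 2 / n%:R))
  (fun w => Sc w ^+ 2 + Ss w ^+ 2)) => //.
by apply: measurable_funD; exact: measurable_funX.
Qed.

Lemma measurable_threshold_error : measurable_fun setT threshold_error.
Proof.
have mk : measurable_fun setT kept.
  apply: (measurable_fun_bool true) => //.
  by rewrite setTI.
apply: measurable_fun_ifT => //.
by apply: measurable_funD; apply: measurable_funX; apply: measurable_funB.
Qed.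

Let error2 w := (Sc w - alpha) ^+ 2 + (Ss w - beta) ^+ 2.

Let alpha1 : `|alpha| <= 1. Proof. by rewrite -f1; exact: norm_fcos_le. Qed.
Let beta1 : `|beta| <= 1. Proof. by rewrite -f1; exact: norm_fsin_le. Qed.

Let sqr_dist_le (x y : R) : `|x| <= 1 -> `|y| <= 1 -> (x - y) ^+ 2 <= 4.
Proof.
rewrite !ler_norml => /andP[? ?] /andP[? ?]; rewrite -subr_ge0.
rewrite (_ : _ - _ = (2 - (x - y)) * (2 + (x - y))); last by ring.
by rewrite mulr_ge0//; lra.
Qed.

Let sqrS_le w : (Sc w - alpha) ^+ 2 <= 4 /\ (Ss w - beta) ^+ 2 <= 4.
Proof. by split; apply: sqr_dist_le => //; exact: sample_mean_le1. Qed.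

Let error2_le w : 0 <= error2 w <= 8.
Proof. by have [? ?] := sqrS_le w; rewrite addr_ge0 ?sqr_ge0//= /error2;
  lra. Qed.

Let merror2 : measurable_fun setT error2.
Proof. by apply: measurable_funD; apply: measurable_funX;
  apply: measurable_funB. Qed.

Let ierror2 : P.-integrable setT (EFin \o error2).
Proof.
apply: (@bounded_prob_integrable _ _ _ P 8) => // w.
by have /andP[? ?] := error2_le w; rewrite ger0_norm.
Qed.

Lemma threshold_error_bnd w : 0 <= threshold_error w <= 8.
Proof.
rewrite /threshold_error; case: ifP => _; first exact: error2_le.
have := alpha1; have := beta1; rewrite addr_ge0 ?sqr_ge0//=.
move=> b1 a1; have := sqr_dist_le a1 (y := 0); have := sqr_dist_le b1 (y := 0).
by rewrite !subr0 normr0 => /(_ ler01) ? /(_ ler01) ?; lra.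
Qed.

Lemma integrable_threshold_error : P.-integrable setT (EFin \o threshold_error).
Proof.
apply: (@bounded_prob_integrable _ _ _ P 8);
  first exact: measurable_threshold_error.
by move=> w; have /andP[? ?] := threshold_error_bnd w; rewrite ger0_norm.
Qed.

(** The variances of the real and imaginary parts add up to (1 - |phi|^2) /
    n. *)
Let error2_mean : \int[P]_w error2 w <= n%:R^-1.
Proof.
have i1 : P.-integrable setT (EFin \o (fun w => (Sc w - alpha) ^+ 2)).
  apply: (@bounded_prob_integrable _ _ _ P 4).
    by apply: measurable_funX; apply: measurable_funB.
  by move=> w; rewrite ger0_norm ?sqr_ge0//; have [] := sqrS_le w.
have i2 : P.-integrable setT (EFin \o (fun w => (Ss w - beta) ^+ 2)).
  apply: (@bounded_prob_integrable _ _ _ P 4).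
    by apply: measurable_funX; apply: measurable_funB.
  by move=> w; rewrite ger0_norm ?sqr_ge0//; have [] := sqrS_le w.
rewrite RintegralD//.
rewrite (sample_mean_variance mZ indepZ f0 fi f1 lawZ mc c1 n0).
rewrite (sample_mean_variance mZ indepZ f0 fi f1 lawZ ms s1 n0).
rewrite -mulrDr ler_piMr ?invr_ge0//.
have j1 : mu.-integrable setT (EFin \o (fun x => cos (u * x) ^+ 2 * f x)).
  apply: (integrable_mul_density f0 fi (K := 1)); first exact: measurable_funX.
  by move=> x; rewrite normrX exprn_ile1.
have j2 : mu.-integrable setT (EFin \o (fun x => sin (u * x) ^+ 2 * f x)).
  apply: (integrable_mul_density f0 fi (K := 1)); first exact: measurable_funX.
  by move=> x; rewrite normrX exprn_ile1.
have : \int[mu]_x (cos (u * x) ^+ 2 * f x) + \int[mu]_x (sin (u * x) ^+ 2 * f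
  x) = 1.
  rewrite -RintegralD// -[RHS]f1; apply: eq_Rintegral => x _.
  by rewrite -mulrDl cos2Dsin2 mul1r.
have := sqr_ge0 (\int[mu]_x (cos (u * x) * f x)).
have := sqr_ge0 (\int[mu]_x (sin (u * x) * f x)).
lra.
Qed.

(** The error is at most |phihat - phi| plus the level kn / sqrt n. Squaring the
    sum with the weights 1 + kn and 1 + 1 / kn balances the two contributions,
    since E|phihat - phi|^2 <= 1/n. *)
Lemma threshold_risk_variance :
  \int[P]_w threshold_error w <= (1 + kn) ^+ 2 / n%:R.
Proof.
have kn0 : 0 < kn by exact: lt_le_trans kn1.
have I1 := integrableZR (1 + kn) ierror2.
have I2 : P.-integrable setT (EFin \o cst ((kn ^+ 2 + kn) / n%:R)).
  exact: finite_measure_integrable_cst.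
have I12 := integrableDR I1 I2.
apply: (@le_trans _ _ (\int[P]_w ((1 + kn) * error2 w + (kn ^+ 2 + kn)
  / n%:R))).
  apply: le_Rintegral => //; first exact: integrable_threshold_error.
  move=> w _; rewrite /threshold_error -/(error2 w).
  have e0 : 0 <= error2 w by have /andP[] := error2_le w.
  have r0 : 0 <= (kn ^+ 2 + kn) / n%:R :=
    divr_ge0 (addr_ge0 (sqr_ge0 _) (ltW kn0)) (ltW nR).
  case: ifPn => [_|]; first by have := mulr_ge0 (ltW kn0) e0; lra.
  rewrite kept_sqr -ltNge => Slt.
  have split2 (x y : R) : y ^+ 2 <= (1 + kn) * (x - y) ^+ 2 + (1 + kn^-1)
    * x ^+ 2.
    rewrite -subr_ge0.
    rewrite (_ : _ - _ = kn^-1 * (kn * (x - y) + x) ^+ 2); last by field;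
      rewrite gt_eqF.
    by rewrite mulr_ge0 ?sqr_ge0// invr_ge0 ltW.
  have h1 := split2 (Sc w) alpha; have h2 := split2 (Ss w) beta.
  have kinv : 0 <= 1 + kn^-1 by rewrite addr_ge0// invr_ge0 ltW.
  have := ler_wpM2l kinv (ltW Slt).
  have -> : (1 + kn^-1) * (kn ^+ 2 / n%:R) = (kn ^+ 2 + kn) / n%:R.
    by field; rewrite !gt_eqF.
  rewrite /error2; lra.
rewrite RintegralD// (@RintegralZl _ _ _ P setT error2)// Rintegral_prob_cst.
have := ler_wpM2l (addr_ge0 ler01 (ltW kn0)) error2_mean.
rewrite (_ : (1 + kn) ^+ 2 / n%:R = (1 + kn) * n%:R^-1 + (kn ^+ 2 + kn) / n%:R);
  last first.
  by field; rewrite gt_eqF.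
lra.
Qed.

Let q := Num.sqrt (2 * n%:R) : R.
Let q0 : 0 < q. Proof. by rewrite sqrtr_gt0 mulr_gt0. Qed.
Let q2 : q ^+ 2 = 2 * n%:R. Proof. by rewrite sqr_sqrtr// mulr_ge0. Qed.
Let t := kn / q.

(** With q = sqrt (2n) the level is t = kn / q. A mean of size at most 1/(2q)
    leaves t - |m| >= kappa * sqrt (ln n) / q, and the exponent is kappa^2 ln n
    / 4. *)
Let tail_event (h : R -> R) : measurable_fun setT h ->
  (forall x, `|h x| <= 1) ->
  `|\int[mu]_x (h x * f x)| <= (2 * q)^-1 ->
  (P [set w | (t <= sample_mean Z h w)%R] <=
   (n%:R `^ (- (kappa ^+ 2 / 4)))%:E)%E.
Proof.
move=> mh h1 hm.
have q1 : (2 * q)^-1 <= t.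
  rewrite /t invfM ler_wpM2r ?invr_ge0 ?(ltW q0)//.
  by rewrite (le_trans _ kn1)// invf_le1// ler1n.
apply: (le_trans (sample_mean_tail mZ indepZ f0 fi f1 lawZ mh h1 n0
  (le_trans hm q1))).
rewrite lee_fin /powR gt_eqF// ler_expR mulNr lerN2.
set m := `|_| in hm *.
have kL : kappa * L / q <= t - m.
  apply: (@le_trans _ _ (t - (2 * q)^-1)); last by rewrite lerD2l lerN2.
  rewrite /t /kn /kappa_ -/L invfM -subr_ge0.
  rewrite (_ : _ - _ = 2^-1 * q^-1); last by field; rewrite gt_eqF.
  by rewrite mulr_ge0 ?invr_ge0 ?(ltW q0).
have kL0 : 0 <= kappa * L / q.
  exact: divr_ge0 (mulr_ge0 (ltW kappa0) L0) (ltW q0).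
have : (kappa * L / q) ^+ 2 <= (t - m) ^+ 2.
  by rewrite lerXn2r ?nnegrE// (le_trans kL0).
rewrite exprMn exprVn q2 exprMn sqr_sqrtr; last by rewrite ln_ge0// ler1n.
move=> /(ler_wpM2l (ltW nR)).
rewrite (_ : n%:R * _ = kappa ^+ 2 * ln n%:R / 2); last by field;
  rewrite gt_eqF.
lra.
Qed.

Let mean_small : alpha ^+ 2 + beta ^+ 2 < (8 * n%:R)^-1 ->
  `|alpha| <= (2 * q)^-1 /\ `|beta| <= (2 * q)^-1.
Proof.
move=> small.
have E : (2 * q)^-1 ^+ 2 = (8 * n%:R)^-1.
  by rewrite exprVn exprMn q2; congr (_^-1); ring.
have q1 : 0 <= (2 * q)^-1 by rewrite invr_ge0 mulr_ge0// ltW.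
have aux (x : R) : x ^+ 2 <= (8 * n%:R)^-1 -> `|x| <= (2 * q)^-1.
  move=> xs; rewrite -(@ler_pXn2r _ 2)// ?nnegrE//.
  by rewrite real_normK ?num_real// E.
have a2 := sqr_ge0 alpha; have b2 := sqr_ge0 beta.
by split; apply: aux; lra.
Qed.

(** Surviving the threshold means that the squares of the two parts add up to at
    least 2 t^2. *)
Let keep_or w : kept w -> [\/ t <= Sc w, t <= - Sc w, t <= Ss w | t <= - Ss w].
Proof.
rewrite kept_sqr => kw; apply: contrapT => /or4P.
rewrite !negb_or -!ltNge => /and4P[h1 h2 h3 h4].
have t0 : 0 <= t by rewrite divr_ge0// ?(ltW q0)// (le_trans _ kn1).
have sq (x : R) : x < t -> - x < t -> x ^+ 2 < t ^+ 2.
  move=> xt1 xt2; rewrite -(real_normK (num_real x)) ltrXn2r// ?nnegrE//.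
  by rewrite ltr_norml; apply/andP; split; lra.
have := sq _ h1 h2; have := sq _ h3 h4.
have E : kn ^+ 2 / n%:R = 2 * t ^+ 2.
  by rewrite /t exprMn exprVn q2; field; rewrite gt_eqF.
move: kw; rewrite E; lra.
Qed.

Let SN (h : R -> R) w : - sample_mean Z h w = sample_mean Z (fun x => - h x) w.
Proof. by rewrite /sample_mean sumrN mulrN. Qed.

(** The two cases are whether the variance 1/n is dominated by 8 |phi|^2. If it
    is not, keeping the frequency is one of four rare events. *)
Lemma threshold_risk_tail :
  \int[P]_w threshold_error w <=
  9 * (alpha ^+ 2 + beta ^+ 2) + 32 * n%:R `^ (- (kappa ^+ 2 / 4)).
Proof.
set ab := alpha ^+ 2 + beta ^+ 2.
have ab0 : 0 <= ab by rewrite addr_ge0 ?sqr_ge0.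
have pow0 : 0 <= n%:R `^ (- (kappa ^+ 2 / 4)) :> R by exact: powR_ge0.
have iab : P.-integrable setT (EFin \o cst ab)
  by exact: finite_measure_integrable_cst.
have ithr := integrable_threshold_error.
have [big|small] := leP (8 * n%:R)^-1 ab.
  have I2 := integrableDR ierror2 iab.
  apply: (@le_trans _ _ (\int[P]_w (error2 w + ab))).
    apply: le_Rintegral => // w _; rewrite /threshold_error -/(error2 w) -/ab.
    have e0 : 0 <= error2 w by have /andP[] := error2_le w.
    by case: ifP => _; lra.
  rewrite RintegralD// Rintegral_prob_cst.
  have := error2_mean; move: big; rewrite invfM; lra.
have [sa sb] := mean_small small.
pose A1 := [set w | t <= Sc w]; pose A2 := [set w | t <= - Sc w].
pose A3 := [set w | t <= Ss w]; pose A4 := [set w | t <= - Ss w].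
have mle (X : Omega -> R) : measurable_fun setT X ->
  measurable [set w | t <= X w].
  move=> mX; rewrite -[X in measurable X]setTI.
  exact: (@measurable_fun_ler _ _ _ _ (cst t) X).
have m1 : measurable A1 by exact: mle.
have m2 : measurable A2 by apply: mle; exact: measurable_funN.
have m3 : measurable A3 by exact: mle.
have m4 : measurable A4 by apply: mle; exact: measurable_funN.
have iI A : measurable A -> P.-integrable setT (EFin \o (\1_A : Omega -> R)).
  move=> mA; apply: (@bounded_prob_integrable _ _ _ P 1);
    first exact: measurable_indic.
  by move=> w; rewrite indicE; case: (_ \in _); rewrite ?normr1 ?normr0.
have J1 := iI _ m1; have J2 := iI _ m2; have J3 := iI _ m3; have J4 := iI _ m4.
have J12 := integrableDR J1 J2.
have J123 := integrableDR J12 J3.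
have J1234 := integrableDR J123 J4.
have K8 := integrableZR 8 J1234.
have K := integrableDR iab K8.
have IE A : measurable A -> (P A <= (n%:R `^ (- (kappa ^+ 2 / 4)))%:E)%E ->
    \int[P]_w \1_A w <= n%:R `^ (- (kappa ^+ 2 / 4)).
  move=> mA; rewrite -lee_fin EFin_Rintegral//; last exact: iI.
  by rewrite integral_indic// setIT.
have P1 := IE _ m1 (tail_event mc c1 sa).
have P3 := IE _ m3 (tail_event ms s1 sb).
have P2 : \int[P]_w \1_A2 w <= n%:R `^ (- (kappa ^+ 2 / 4)).
  apply: IE => //; rewrite /A2; under eq_set do rewrite SN.
  apply: tail_event; first exact: measurable_funN.
    by move=> x; rewrite normrN.
  under eq_Rintegral do rewrite mulNr -mulN1r.
  rewrite RintegralZl ?mulN1r ?normrN//.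
  exact: (integrable_mul_density f0 fi (K := 1)).
have P4 : \int[P]_w \1_A4 w <= n%:R `^ (- (kappa ^+ 2 / 4)).
  apply: IE => //; rewrite /A4; under eq_set do rewrite SN.
  apply: tail_event; first exact: measurable_funN.
    by move=> x; rewrite normrN.
  under eq_Rintegral do rewrite mulNr -mulN1r.
  rewrite RintegralZl ?mulN1r ?normrN//.
  exact: (integrable_mul_density f0 fi (K := 1)).
apply: (@le_trans _ _ (\int[P]_w (ab + 8 * (\1_A1 w + \1_A2 w + \1_A3 w
  + \1_A4 w)))).
  apply: le_Rintegral => // w _.
  have ind0 A : 0 <= \1_A w :> R by rewrite indicE.
  have i1 := ind0 A1; have i2 := ind0 A2; have i3 := ind0 A3; have i4 :=
    ind0 A4.
  rewrite /threshold_error -/(error2 w) -/ab; case: ifPn => [kw|_]; last lra.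
  have /andP[_ e8] := error2_le w.
  have ind1 A : A w -> 1 <= \1_A w :> R by move=> Aw; rewrite indicE mem_set.
  have : 1 <= \1_A1 w + \1_A2 w + \1_A3 w + \1_A4 w :> R.
    by case: (keep_or kw) => h; [have := ind1 A1 h|have := ind1 A2 h|have :=
      ind1 A3 h|have := ind1 A4 h]; lra.
  lra.
rewrite RintegralD// Rintegral_prob_cst.
rewrite (@RintegralZl _ _ _ P setT (fun w => \1_A1 w + \1_A2 w + \1_A3 w
  + \1_A4 w))//.
rewrite RintegralD// RintegralD// RintegralD//.
lra.
Qed.

End threshold_risk.

(** * Risk integrated over the frequencies *)

Section integrated_risk.
Context d (Omega : measurableType d) (R : realType) (P : probability Omega R).
Notation mu := (@lebesgue_measure R).
Notation RR := (measurableTypeR R).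
Context (n : nat) (Z : 'I_n -> Omega -> R) (f : R -> R).
Hypotheses (mZ : forall j, measurable_fun setT (Z j))
  (indepZ : mutually_independent P Z)
  (f0 : forall x, 0 <= f x) (fi : mu.-integrable setT (EFin \o f))
  (f1 : \int[mu]_x f x = 1)
  (lawZ : forall j B, measurable B ->
    (P (Z j @^-1` B) = \int[mu]_(x in B) (f x)%:E)%E)
  (n0 : (0 < n)%N).
Variables (kappa : R) (kappa0 : 0 < kappa).

Let nR : 0 < n%:R :> R. Proof. by rewrite ltr0n. Qed.

Let measurable_sample_mean2 (g : R -> R) : continuous g ->
  measurable_fun setT (fun z : Omega * RR => sample_mean Z
    (fun x => g (z.2 * x)) z.1).
Proof.
move=> cg; apply: measurable_funM; first exact: measurable_cst.
apply: measurable_sum => j.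
apply: (measurableT_comp (continuous_measurable_fun cg)).
apply: measurable_funM; first exact: measurable_snd.
exact: measurableT_comp (mZ j) (@measurable_fst _ _ _ _).
Qed.

Lemma measurable_threshold_error2 : measurable_fun setT
  (fun z : Omega * RR => threshold_error Z f kappa z.2 z.1).
Proof.
have mC := measurable_sample_mean2 (@continuous_cos R).
have mS := measurable_sample_mean2 (@continuous_sin R).
have ma : measurable_fun setT (fun z : Omega * RR => fcos f z.2).
  exact: measurableT_comp (measurable_fcos f0 fi) (@measurable_snd _ _ _ _).
have mb : measurable_fun setT (fun z : Omega * RR => fsin f z.2).
  exact: measurableT_comp (measurable_fsin f0 fi) (@measurable_snd _ _ _ _).
rewrite /threshold_error; apply: measurable_fun_ifT.
- under eq_fun do rewrite kept_sqr//.
  apply: measurable_fun_ler; first exact: measurable_cst.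
  by apply: measurable_funD; apply: measurable_funX.
- by apply: measurable_funD; apply: measurable_funX; apply: measurable_funB.
- by apply: measurable_funD; apply: measurable_funX.
Qed.

Let F (z : Omega * RR) := \1_(`]- (n%:R : R), n%:R[%classic : set R) z.2
  * threshold_error Z f kappa z.2 z.1.

Let cut_errorE u w : cut n%:R (fun u => threshold_error Z f kappa u w) u
  = F (w, u).
Proof.
by rewrite /F cutE indicE /=; case: ifP; rewrite ?mul1r ?mul0r.
Qed.

Let mF : measurable_fun setT F.
Proof.
apply: measurable_funM; last exact: measurable_threshold_error2.
have mi : measurable_fun setT (\1_(`]- (n%:R : R), n%:R[%classic : set R) :
  R -> R).
  exact: measurable_indic.
exact: measurableT_comp mi (@measurable_snd _ _ _ _).
Qed.

Let q (u : RR) : R := 8 * \1_(`[- (n%:R : R), n%:R]%classic : set R) u.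
Let iq : mu.-integrable setT (EFin \o q).
Proof. exact: (integrableZR 8 (integrable_itv_indic n%:R)). Qed.

Let i1 : P.-integrable setT (EFin \o cst (1 : R)).
Proof. exact: finite_measure_integrable_cst. Qed.

Let q0 u : 0 <= q u. Proof. by rewrite mulr_ge0// indicE. Qed.

Let F_le w u : `|F (w, u)| <= cst 1 w * q u.
Proof.
have /andP[t0 t8] := threshold_error_bnd Z f0 fi f1 n0 kappa u w.
rewrite /F /q /= mul1r normrM (ger0_norm t0) mulrC.
rewrite ler_pM// !indicE; case: (boolP (u \in _)) => [|_];
  last by rewrite normr0.
rewrite inE/= in_itv/= => /andP[u1 u2]; rewrite mem_set ?normr1//=.
by rewrite in_itv/= !ltW.
Qed.

Lemma integrable_integrated_error : P.-integrable setT (EFin \o (fun w =>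
  \int[mu]_u cut n%:R (fun u => threshold_error Z f kappa u w) u)).
Proof.
have := integrable_Rintegral1 mF i1 iq (fun=> ler01) q0 F_le.
apply: eq_integrable => // w _ /=.
by under [in RHS]eq_Rintegral do rewrite cut_errorE.
Qed.

Let cut_cst (m : R) : 0 < m -> \int[mu]_u cut m (cst 1) u = 2 * m.
Proof.
move=> m0; rewrite /cut -Rintegral_mkcond Rintegral_cst// mul1r.
transitivity (fine (mu `]- m, m[%classic)) => //.
rewrite lebesgue_measure_itv/= lte_fin.
by rewrite gtrN// -EFinB /= opprK mulr_natl mulr2n.
Qed.

Let psi u := fcos f u ^+ 2 + fsin f u ^+ 2.

Let icut (m K : R) (p : R -> R) : measurable_fun setT p ->
  (forall u, `|p u| <= K) ->
  mu.-integrable setT (EFin \o cut m p).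
Proof. by move=> mp pK; apply: supported_integrable (supported_cut m mp
  pK). Qed.

Let ipsi m : mu.-integrable setT (EFin \o cut m psi).
Proof.
apply: (@icut _ 2).
  by apply: measurable_funD; apply: measurable_funX;
    [exact: measurable_fcos|exact: measurable_fsin].
move=> u; rewrite ger0_norm ?addr_ge0 ?sqr_ge0//.
have sq (x : R) : `|x| <= 1 -> x ^+ 2 <= 1.
  by move=> x1; rewrite -(real_normK (num_real x)) exprn_ile1.
have h1 : fcos f u ^+ 2 <= 1 by apply: sq; rewrite -f1; exact: norm_fcos_le.
have h2 : fsin f u ^+ 2 <= 1 by apply: sq; rewrite -f1; exact: norm_fsin_le.
exact: lerD h1 h2.
Qed.

Let ic m : mu.-integrable setT (EFin \o cut m (cst 1)).
Proof. by apply: (@icut _ 1) => // u; rewrite normr1. Qed.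

(** At each frequency the smaller of the two bounds available is chosen: the
    variance bound below m, the tail bound between m and n. *)
Lemma integrated_threshold_risk (m : R) : 0 < m -> m <= n%:R ->
  \int[P]_w (\int[mu]_u cut n%:R (fun u => threshold_error Z f kappa u w) u) <=
  2 * m * ((1 + kappa_ n kappa) ^+ 2 / n%:R) +
  9 * (\int[mu]_u cut n%:R psi u - \int[mu]_u cut m psi u) +
  2 * n%:R * (32 * n%:R `^ (- (kappa ^+ 2 / 4))).
Proof.
move=> m0 mn.
set V := (1 + _) ^+ 2 / _; set W := 32 * _.
have V0 : 0 <= V by rewrite divr_ge0 ?sqr_ge0.
have W0 : 0 <= W by rewrite mulr_ge0 ?powR_ge0.
under eq_Rintegral do under eq_Rintegral do rewrite cut_errorE.
rewrite (Rintegral_exchange mF i1 iq (fun=> ler01) q0 F_le).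
have I1 := integrableZR V (ic m).
have I2 := integrableBR (ipsi n%:R) (ipsi m).
have I3 := integrableZR 9 I2.
have I4 := integrableZR W (ic n%:R).
have I5 := integrableDR I1 I3.
have I6 := integrableDR I5 I4.
apply: (@le_trans _ _ (\int[mu]_u (V * cut m (cst 1) u +
    9 * (cut n%:R psi u - cut m psi u) + W * cut n%:R (cst 1) u))).
  apply: le_Rintegral => //.
    exact: integrable_Rintegral2 mF i1 iq (fun=> ler01) q0 F_le.
  move=> u _.
  have psi0 : 0 <= psi u by rewrite addr_ge0 ?sqr_ge0.
  have [un|nu] := ltP `|u| n%:R; last first.
    have mu' := le_trans mn nu.
    rewrite !cut0// subrr !mulr0 !addr0.
    by under eq_Rintegral do rewrite -cut_errorE cut0//;
      rewrite Rintegral_prob_cst.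
  under eq_Rintegral do rewrite -cut_errorE cut_id//.
  rewrite !(@cut_id _ n%:R)//= mulr1.
  have [um|mu'] := ltP `|u| m.
    rewrite !cut_id//= subrr mulr0 addr0 mulr1.
    have := threshold_risk_variance mZ indepZ f0 fi f1 lawZ n0 kappa0 u.
    rewrite -/V; lra.
  rewrite !(@cut0 _ m)// mulr0 add0r subr0.
  exact: (threshold_risk_tail mZ indepZ f0 fi f1 lawZ n0 kappa0 u).
rewrite RintegralD// RintegralD//.
rewrite (@RintegralZl _ _ _ mu setT (cut m (cst 1)))//.
rewrite (@RintegralZl _ _ _ mu setT (cut n%:R (cst 1)))//.
rewrite (@RintegralZl _ _ _ mu setT (fun u => cut n%:R psi u - cut m psi u))//.
rewrite RintegralB// !cut_cst//; lra.
Qed.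

End integrated_risk.

(** * Complex-valued notions in real terms, and the sample of increments *)

Section complex_link.
Context (R : realType).
Notation mu := (@lebesgue_measure R).

Lemma empirical_char_funE n (z : 'I_n -> R) u :
  empirical_char_fun z u =
  (n%:R^-1 * \sum_(j < n) cos (u * z j)) +i*
  (n%:R^-1 * \sum_(j < n) sin (u * z j)).
Proof.
rewrite /empirical_char_fun.
have -> : \sum_(j < n) cis (u * z j) =
    (\sum_(j < n) cos (u * z j)) +i* (\sum_(j < n) sin (u * z j)).
  elim/big_ind3 : _ => // [x1 x2 x3 y1 y2 y3 -> ->]; first by [].
by apply/eqP; rewrite eq_complex /= !mul0r subr0 addr0 !eqxx.
Qed.

Lemma L2norm_sqr_ge0 (g : R -> R[i]) : (0 <= L2norm g ^+ 2)%E.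
Proof.
by rewrite L2norm_sqr; apply: integral_ge0 => x _;
  rewrite lee_fin addr_ge0 ?sqr_ge0.
Qed.

Lemma L2norm_sqr_error (phi : R -> R[i]) (f : R -> R) (C m : R) : 0 < m ->
  measurable_fun setT (fun u => complex.Re (phi u)) ->
  measurable_fun setT (fun u => complex.Im (phi u)) ->
  (forall u, `|complex.Re (phi u)| <= C) ->
  (forall u, `|complex.Im (phi u)| <= C) ->
  let a := cut m (fun u => complex.Re (phi u)) in
  let b := cut m (fun u => complex.Im (phi u)) in
  (L2norm (fun x => (truncated_inverse_fourier phi m x - (f x)%:C)%R) ^+ 2 =
   \int[mu]_x (((2 * pi)^-1 * trig a b x - f x) ^+ 2 +
               ((2 * pi)^-1 * trig b (fun u => - a u)%R x) ^+ 2)%:E)%E.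
Proof.
move=> m0 mp mq pC qC a b; rewrite L2norm_sqr; apply: eq_integral => x _.
by rewrite (truncated_inverse_fourierE x m0 mp mq pC qC) /= oppr0 addr0.
Qed.

(** For n = 1 the logarithm vanishes. For n >= 2 it is at least 1/2, and then
    the terms in kappa * L on the left are dominated by those in kappa * L^2 on
    the right. *)
Lemma penalty_le (n : nat) (kappa : R) : (0 < n)%N -> 0 < kappa ->
  (1 + kappa_ n kappa) ^+ 2 <=
  5 + (1 + (kappa + 2) * Num.sqrt (ln n%:R)) ^+ 2 :> R.
Proof.
move=> n0 kappa0; rewrite /kappa_; set L := Num.sqrt _.
have L0 : 0 <= L by exact: sqrtr_ge0.
have [n1|n2] := leqP n 1.
  have -> : L = 0.
    rewrite /L (_ : n = 1%N) ?ln1 ?sqrtr0//.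
    by apply/eqP; rewrite eqn_leq n1.
  by rewrite !mulr0 !addr0; lra.
have n2R : 2 <= n%:R :> R by rewrite ler_nat.
have nR : 0 < n%:R :> R by rewrite ltr0n.
(* From 1 - ln n <= exp (- ln n) = 1 / n. *)
have ln2 : 1 / 2 <= ln (n%:R : R).
  have := expR_ge1Dx (- ln (n%:R : R)); rewrite expRN lnK ?posrE//.
  have : n%:R^-1 <= 2^-1 :> R by rewrite lef_pV2 ?posrE.
  lra.
have L2 : L ^+ 2 = ln n%:R by rewrite sqr_sqrtr//; lra.
have L12 : 1 / 2 <= L by nra.
have : 0 <= kappa * L * (2 * L - 1) by rewrite !mulr_ge0 ?(ltW kappa0)//; lra.
nra.
Qed.

End complex_link.

Section levy_sample.
Context d (Omega : measurableType d) (R : realType) (P : probability Omega R).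
Variables (X : R -> {RV P >-> R}) (Delta : R) (f : R -> R).
Hypotheses (hDelta : 0 < Delta) (hX : levy_process X)
  (hf : has_density (X Delta) f).
Notation mu := (@lebesgue_measure R).

Lemma density_integral : (\int[mu]_x (f x)%:E = 1)%E.
Proof. by have [_ _ <-//] := hf; rewrite probability_setT. Qed.

Lemma density_integrable : mu.-integrable setT (EFin \o f).
Proof.
have [mf f0 _] := hf; apply/integrableP; split; first exact/measurable_EFinP.
under eq_integral do rewrite /= ger0_norm//.
rewrite density_integral; exact: ltry.
Qed.

(** The density gives the law of the single variable X_Delta, seen as a sample
    of size one. *)
Lemma char_fun_density u : char_fun (X Delta) u = fcos f u +i* fsin f u.
Proof.
move: (hf) => [mf f0 lawf].
have f1 : \int[mu]_x f x = 1 by rewrite /Rintegral density_integral.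
have E (g : R -> R) : measurable_fun setT g -> (forall y, `|g y| <= 1) ->
    \int[P]_w g (X Delta w) = \int[mu]_x (g x * f x).
  move=> mg g1.
  apply: (@expectation_law _ _ _ P 1 (fun _ w => X Delta w) f _ f0
    density_integrable f1 _ g 1 ord0 mg g1) => //.
rewrite /char_fun /cintegral /cis /=; congr (_ +i* _).
  by apply: (E (fun y => cos (u * y))); [exact: measurable_cosM|move=> y;
    exact: norm_cos_le1].
by apply: (E (fun y => sin (u * y))); [exact: measurable_sinM|move=> y;
  exact: norm_sin_le1].
Qed.

Variable n : nat.

Let Z (j : 'I_n) (w : Omega) := increments X Delta n w j.

Lemma measurable_increments j : measurable_fun setT (Z j).
Proof. by apply: measurable_funB. Qed.

Lemma increments_independent : mutually_independent P Z.
Proof.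
have [_ indep _ _ _] := hX.
apply: (indep n (fun i => i%:R * Delta)); first by rewrite mul0r.
by move=> i _; rewrite ltr_pM2r// ltr_nat.
Qed.

Lemma increments_law j B : measurable B ->
  (P (Z j @^-1` B) = \int[mu]_(x in B) (f x)%:E)%E.
Proof.
move=> mB; have [_ _ stat _ _] := hX; have [_ _ <-//] := hf.
have := stat (j%:R * Delta) Delta (mulr_ge0 (ler0n _ _) (ltW hDelta))
  (ltW hDelta) B mB.
have -> : j%:R * Delta + Delta = j.+1%:R * Delta by rewrite -natr1 mulrDl mul1r.
by [].
Qed.

End levy_sample.

(** * The oracle inequality *)

Section oracle.
Context d (Omega : measurableType d) (R : realType) (P : probability Omega R).
Variables (X : R -> {RV P >-> R}) (Delta : R) (f : R -> R) (n : nat)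
  (kappa : R).
Hypotheses (hDelta : 0 < Delta) (hX : levy_process X)
  (hf : has_density (X Delta) f) (n0 : (0 < n)%N) (kappa0 : 0 < kappa).
Notation mu := (@lebesgue_measure R).

Let f0 : forall x, 0 <= f x. Proof. by have [] := hf. Qed.
Let fi := density_integrable hf.
Let f1 : \int[mu]_x f x = 1.
Proof. by rewrite /Rintegral (density_integral hf). Qed.
Let nR : 0 < n%:R :> R. Proof. by rewrite ltr0n. Qed.
Let Z (j : 'I_n) (w : Omega) := increments X Delta n w j.
Let mZ : forall j, measurable_fun setT (Z j).
Proof. exact: measurable_increments. Qed.
Let indepZ : mutually_independent P Z.
Proof. exact: increments_independent. Qed.
Let lawZ : forall j B, measurable B ->
  (P (Z j @^-1` B) = \int[mu]_(x in B) (f x)%:E)%E.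
Proof. exact: increments_law. Qed.

Let psi u := fcos f u ^+ 2 + fsin f u ^+ 2.
Let F2 := \int[mu]_x f x ^+ 2.
Let N m := \int[mu]_u cut m psi u.
Let c : R := (2 * pi)^-1.

Let bias m : 0 < m ->
  let a := cut m (fcos f) in let b := cut m (fsin f) in
  (L2norm (fun x => (truncated_inverse_fourier (char_fun (X Delta)) m x
    - (f x)%:C)%R) ^+ 2 =
   \int[mu]_x ((c * trig a b x - f x) ^+ 2 +
               (c * trig b (fun u => - a u)%R x) ^+ 2)%:E)%E.
Proof.
move=> m0.
have reE : (fun u => complex.Re (char_fun (X Delta) u)) = fcos f.
  by apply/funext => u; rewrite (char_fun_density hf).
have imE : (fun u => complex.Im (char_fun (X Delta) u)) = fsin f.
  by apply/funext => u; rewrite (char_fun_density hf).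
rewrite (@L2norm_sqr_error _ _ _ 1 m m0) ?reE ?imE//.
- exact: measurable_fcos.
- exact: measurable_fsin.
- by move=> u; rewrite (char_fun_density hf) /= -f1; exact: norm_fcos_le.
- by move=> u; rewrite (char_fun_density hf) /= -f1; exact: norm_fsin_le.
Qed.

(** What the band [-m, m] misses of the L2 norm of f, by Plancherel's
    identity. *)
Let bias_eq m : 0 < m -> mu.-integrable setT (EFin \o (fun x => f x ^+ 2)) ->
  (L2norm (fun x => (truncated_inverse_fourier (char_fun (X Delta)) m x
    - (f x)%:C)%R) ^+ 2 =
   (F2 - c * N m)%:E)%E.
Proof.
move=> m0 f2i; rewrite bias//.
have mfc := measurable_fcos f0 fi; have mfs := measurable_fsin f0 fi.
apply: (@error_eq _ f f0 fi m 1) => //.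
- by move=> u; rewrite -f1; exact: norm_fcos_le.
- by move=> u; rewrite -f1; exact: norm_fsin_le.
Qed.

Let estimation_le w : mu.-integrable setT (EFin \o (fun x => f x ^+ 2)) ->
  (L2norm (fun x => (adaptive_estimator (increments X Delta n w) kappa x
    - (f x)%:C)%R) ^+ 2 <=
   (c * \int[mu]_u cut n%:R (fun u => threshold_error Z f kappa u w) u +
    (F2 - c * N n%:R))%:E)%E.
Proof.
move=> f2i.
pose Sc u := sample_mean Z (fun x => cos (u * x)) w.
pose Ss u := sample_mean Z (fun x => sin (u * x)) w.
have ecfE u : empirical_char_fun (increments X Delta n w) u = Sc u +i* Ss u.
  exact: empirical_char_funE.
pose phi u := thresholded_char_fun (increments X Delta n w) kappa u.
have keptE u : (kappa_ n kappa / Num.sqrt n%:R <=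
    cabs (empirical_char_fun (increments X Delta n w) u)) = kept Z kappa u w.
  by rewrite ecfE.
have phiE u : phi u = if kept Z kappa u w then Sc u +i* Ss u else 0.
  by rewrite /phi /thresholded_char_fun keptE; case: ifP => // _; rewrite ecfE.
have reE u : complex.Re (phi u) = if kept Z kappa u w then Sc u else 0.
  by rewrite phiE; case: ifP.
have imE u : complex.Im (phi u) = if kept Z kappa u w then Ss u else 0.
  by rewrite phiE; case: ifP.
have mS (g : R -> R) : continuous g ->
    measurable_fun setT (fun u : R => sample_mean Z (fun x => g (u * x)) w).
  move=> cg; apply: measurable_funM; first exact: measurable_cst.
  apply: measurable_sum => j; apply: continuous_measurable_fun => u.
  by apply: continuous_comp; [exact: mulrr_continuous|exact: cg].
have mSc : measurable_fun setT Sc := mS _ (@continuous_cos R).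
have mSs : measurable_fun setT Ss := mS _ (@continuous_sin R).
have mk : measurable_fun setT (fun u : R => kept Z kappa u w).
  under eq_fun do rewrite kept_sqr//.
  apply: measurable_fun_ler; first exact: measurable_cst.
  by apply: measurable_funD; exact: measurable_funX.
have mre : measurable_fun setT (fun u => complex.Re (phi u)).
  by under eq_fun do rewrite reE; apply: measurable_fun_ifT => //;
    exact: measurable_cst.
have mim : measurable_fun setT (fun u => complex.Im (phi u)).
  by under eq_fun do rewrite imE; apply: measurable_fun_ifT => //;
    exact: measurable_cst.
have re1 u : `|complex.Re (phi u)| <= 1.
  rewrite reE; case: ifP => _; last by rewrite normr0.
  by apply: sample_mean_le1 => // x; exact: norm_cos_le1.
have im1 u : `|complex.Im (phi u)| <= 1.
  rewrite imE; case: ifP => _; last by rewrite normr0.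
  by apply: sample_mean_le1 => // x; exact: norm_sin_le1.
rewrite /adaptive_estimator (@L2norm_sqr_error _ phi f 1 n%:R nR mre mim
  re1 im1).
apply: le_trans (error_le f0 fi nR mre mim re1 im1 f2i) _.
rewrite lee_fin lerD2r ler_wpM2l ?invr_ge0 ?mulr_ge0 ?pi_ge0//.
rewrite le_eqVlt; apply/orP; left; apply/eqP; apply: eq_Rintegral => u _.
rewrite !cutE; case: ifP => // _.
rewrite reE imE /threshold_error; case: ifP => // _.
by rewrite !sub0r !sqrrN.
Qed.

(** If the bias is infinite there is nothing to prove; otherwise f is square
    integrable. The residual |f|^2 - c |phi|^2_{L2(-n,n)} is the bias at n,
    hence nonnegative, so that it may be multiplied by 9 as well. *)
Lemma oracle_inequality m : 0 < m -> m <= n%:R ->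
  (\int[P]_w (L2norm (fun x : R =>
      (adaptive_estimator (increments X Delta n w) kappa x - (f x)%:C)%R) ^+ 2)
        <=
   9%:E * L2norm (fun x : R =>
      (truncated_inverse_fourier (char_fun (X Delta)) m x - (f x)%:C)%R) ^+ 2 +
   (m / (pi * n%:R) * (5 + (1 + (kappa + 2) * Num.sqrt (ln n%:R)) ^+ 2))%:E +
   (64 * n%:R `^ (1 - kappa ^+ 2 / 4))%:E)%E.
Proof.
move=> m0 mn.
have [biasy|] := ltP (L2norm (fun x : R =>
  (truncated_inverse_fourier (char_fun (X Delta)) m x - (f x)%:C)%R) ^+ 2)%E
    +oo%E; last first.
  rewrite leye_eq => /eqP ->.
  (* The bias term is +oo. *)
  rewrite gt0_muley ?lte_fin// !addye ?leey//.
have mfc := measurable_fcos f0 fi; have mfs := measurable_fsin f0 fi.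
have f2i : mu.-integrable setT (EFin \o (fun x => f x ^+ 2)).
  move: biasy; rewrite bias//.
  apply: (@square_integrable_density _ f fi m 1) => //.
  - by move=> u; rewrite -f1; exact: norm_fcos_le.
  - by move=> u; rewrite -f1; exact: norm_fsin_le.
rewrite bias_eq//.
have residual : 0 <= F2 - c * N n%:R.
  by rewrite -lee_fin -bias_eq//; exact: L2norm_sqr_ge0.
pose err w := \int[mu]_u cut n%:R (fun u => threshold_error Z f kappa u w) u.
have ierr : P.-integrable setT (EFin \o err).
  exact: integrable_integrated_error.
have I1 := integrableZR c ierr.
have I2 : P.-integrable setT (EFin \o cst (F2 - c * N n%:R)).
  exact: finite_measure_integrable_cst.
have I12 := integrableDR I1 I2.
apply: (@le_trans _ _ (\int[P]_w (c * err w + (F2 - c * N n%:R))%:E)%E).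
  apply: le_integral_nonmeasurable => w; first exact: L2norm_sqr_ge0.
  exact: estimation_le.
rewrite -(EFin_Rintegral _ I12)// -EFinM -!EFinD lee_fin.
rewrite RintegralD// (@RintegralZl _ _ _ P setT err)// Rintegral_prob_cst.
have risk := integrated_threshold_risk mZ indepZ f0 fi f1 lawZ n0 kappa0 m0 mn.
have c0 : 0 <= c by rewrite invr_ge0 mulr_ge0// pi_ge0.
have := ler_wpM2l c0 risk; rewrite -/(N m) -/(N n%:R) -/err.
set W := _ `^ _; set V := (1 + kappa_ _ _) ^+ 2.
have W0 : 0 <= W by exact: powR_ge0.
have -> : n%:R `^ (1 - kappa ^+ 2 / 4) = n%:R * W.
  by rewrite powRD ?powRr1// ?(ltW nR)//; apply/implyP => _; rewrite gt_eqF.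
have cE : c = 2^-1 * pi^-1 by rewrite /c invfM.
have tail_le : c * (2 * n%:R * (32 * W)) <= 64 * (n%:R * W).
  have -> : c * (2 * n%:R * (32 * W)) = 32 * pi^-1 * (n%:R * W).
    by rewrite cE; move: pi^-1 => p; field.
  rewrite ler_wpM2r ?mulr_ge0//.
  have : pi^-1 <= 1 :> R by rewrite invf_le1 ?pi_gt0//
    (le_trans _ (pi_ge2 R))// ler1n.
  lra.
have var_le : c * (2 * m * (V / n%:R)) <= m / (pi * n%:R) *
    (5 + (1 + (kappa + 2) * Num.sqrt (ln n%:R)) ^+ 2).
  have -> : c * (2 * m * (V / n%:R)) = m / (pi * n%:R) * V.
    by rewrite cE invfM; move: pi^-1 n%:R^-1 => p q; field.
  rewrite ler_wpM2l//; last exact: penalty_le.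
  by rewrite divr_ge0 ?(ltW m0)// mulr_ge0// pi_ge0.
lra.
Qed.

End oracle.

Unset Implicit Arguments.
Set Strict Implicit.
Set Printing Implicit Defensive.

Theorem theorem4 (R : realType) (d : measure_display) (Omega : measurableType d)
    (P : probability Omega R) (X : R -> {RV P >-> R}) (Delta : R) (f : R -> R)
    (n : nat) (kappa : R)
    (hDelta : 0 < Delta)
    (hX : levy_process X)
    (hf : has_density (X Delta) f)
    (hn : (1 <= n)%N)
    (hkappa : 0 < kappa) :
  (\int[P]_w
     (L2norm (fun x : R =>
        (adaptive_estimator (increments X Delta n w) kappa x - (f x)%:C)%R) ^+ 2)
   <= ereal_inf
        [set 9%:E * L2norm (fun x : R =>
                (truncated_inverse_fourier (char_fun (X Delta)) m x
                 - (f x)%:C)%R) ^+ 2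
             + (m / (pi * n%:R)
                * (5 + (1 + (kappa + 2) * Num.sqrt (ln n%:R)) ^+ 2))%:E
        | m in `]0%R, n%:R]]
      + (64 * n%:R `^ (1 - kappa ^+ 2 / 4))%:E)%E.
Proof.
rewrite -leeBlDr//; apply: le_ereal_inf_tmp => _ [m m0n <-].
have [m0 mn] : 0 < m /\ m <= n%:R.
  by move: m0n; rewrite /= in_itv/= => /andP[].
by rewrite leeBlDr//; exact: oracle_inequality.
Qed.
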